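(* Let $\omega$ be a free ultrafilter on $\mathbb{N}$, let $n\ge 2$ be an integer, let $\mathbb{F}_n$ be the free group on $n$ generators, and let $A=C^*_{\mathrm{red}}(\mathbb{F}_n)$ be its reduced group $C^*$-algebra. Then the central sequence algebra $A'\cap A_\omega$ is not commutative.
   Context: For a $C^*$-algebra $A$, let $\ell_\infty(A)$ be the $C^*$-algebra of bounded sequences in $A$, $c_\omega(A)=\{(a_k)\in\ell_\infty(A):\lim_{k\to\omega}\|a_k\|=0\}$, and $A_\omega=\ell_\infty(A)/c_\omega(A)$ (the norm ultrapower). $A$ is identified with its image in $A_\omega$ via constant sequences, and $A'\cap A_\omega$ is the set of elements of $A_\omega$ commuting with every element of $A$. *)

(* Defs.v *)
From HB Require Import structures.
From mathcomp Require Import all_boot all_order all_algebra.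
From mathcomp Require Import all_classical all_reals all_analysis.
From mathcomp Require Import complex generic_quotient ring_quotient.
From mathcomp Require Import ring lra.
Set Implicit Arguments.
Unset Strict Implicit.
Unset Printing Implicit Defensive.
Import Order.TTheory GRing.Theory Num.Theory.
Import numFieldNormedType.Exports.
Import Normc.
Local Open Scope classical_set_scope.
Local Open Scope ring_scope.
Local Open Scope complex_scope.

(* The free group on 'I_n as the group of reduced words. *)
Section FreeGroup.
Variable n : nat.

(* (i, true) is the i-th generator, (i, false) its inverse. *)
Local Notation letter := ('I_n * bool)%type.
Definition invl (s : letter) : letter := (s.1, ~~ s.2).

Definition reduced (w : seq letter) : bool :=
  sorted (fun s t => t != invl s) w.

(* Left multiplication of a reduced word by a letter. *)
Definition push (s : letter) (w : seq letter) : seq letter :=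
  if w is t :: w' then if t == invl s then w' else s :: w else [:: s].

Lemma invlK : involutive invl.
Proof. by case=> i b; rewrite /invl negbK. Qed.

Lemma reduced_behead s w : reduced (s :: w) -> reduced w.
Proof. by case: w => //= t w /andP[]. Qed.

Lemma reduced_push s w : reduced w -> reduced (push s w).
Proof.
case: w => //= t w tw; case: eqP => [_|/eqP ts]; last by rewrite /= ts.
exact: (@reduced_behead t).
Qed.

Lemma pushK s w : reduced w -> push s (push (invl s) w) = w.
Proof.
case: w => [|t w] /= wred; first by rewrite eqxx.
rewrite invlK; case: eqP => [ts|_]; last by rewrite /= eqxx.
rewrite ts in wred *.
by case: w wred => //= u w /andP[/negPf ut _]; rewrite ut.
Qed.

Record freeGroup : Type := FreeGroup { word : seq letter; _ : reduced word }.
HB.instance Definition _ := [isSub for word].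
HB.instance Definition _ := [Choice of freeGroup by <:].

Lemma reduced_mul (u v : seq letter) : reduced v -> reduced (foldr push v u).
Proof. by move=> vr; elim: u => //= s u /reduced_push. Qed.

Definition freeGroup_one : freeGroup := @FreeGroup [::] isT.
Definition freeGroup_mul (u v : freeGroup) : freeGroup :=
  FreeGroup (reduced_mul (word u) (valP v)).

Lemma reduced_inv (u : freeGroup) : reduced (rev [seq invl s | s <- word u]).
Proof.
case: u => w /=; rewrite /reduced rev_sorted sorted_map.
apply: sub_sorted => s t /=; apply: contraNN => /eqP ->.
by rewrite invlK.
Qed.

Definition freeGroup_inv (u : freeGroup) : freeGroup :=
  FreeGroup (reduced_inv u).

Lemma foldr_push_push s u w : reduced u -> reduced w ->
  foldr push w (push s u) = push s (foldr push w u).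
Proof.
case: u => [|t u] //= ur wr; case: eqP => [->|//].
by rewrite pushK// reduced_mul.
Qed.

Lemma freeGroup_mulA : associative freeGroup_mul.
Proof.
move=> [u ur] [v vr] [w wr]; apply: val_inj => /=.
elim: u ur => //= s u IHu sur; rewrite IHu ?(reduced_behead sur)//.
by rewrite foldr_push_push// reduced_mul.
Qed.

Lemma freeGroup_mul1 : left_id freeGroup_one freeGroup_mul.
Proof. by move=> u; apply: val_inj. Qed.

Lemma freeGroup_mulr1 : right_id freeGroup_one freeGroup_mul.
Proof.
case=> w wr; apply: val_inj => /=; elim: w wr => //= s w IHw swr.
rewrite IHw ?(reduced_behead swr)//.
by case: w swr {IHw} => //= t w /andP[/negPf ->].
Qed.

Lemma freeGroup_mulV : left_inverse freeGroup_one freeGroup_inv freeGroup_mul.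
Proof.
case=> w wr; apply: val_inj => /=; elim: w wr => //= s w IHw swr.
rewrite rev_cons -cats1 foldr_cat /=.
by rewrite invlK eqxx IHw// (reduced_behead swr).
Qed.

Lemma freeGroup_mulrV : right_inverse freeGroup_one freeGroup_inv freeGroup_mul.
Proof.
move=> u; rewrite -[LHS]freeGroup_mul1.
rewrite -{1}(freeGroup_mulV (freeGroup_inv u)) -freeGroup_mulA.
by rewrite (freeGroup_mulA _ u) freeGroup_mulV freeGroup_mul1 freeGroup_mulV.
Qed.

HB.instance Definition _ := isGroup.Build freeGroup freeGroup_mulA
  freeGroup_mul1 freeGroup_mulr1 freeGroup_mulV freeGroup_mulrV.

End FreeGroup.

(* The Hilbert space l^2(I) over R[i]; only its norm is needed. *)
Section ell2.
Variables (R : realType) (I : choiceType).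
Implicit Types f g : I -> R[i].

Definition sqsum f : \bar R := (\esum_(i in setT) (normc (f i) ^+ 2)%:E)%E.

Definition ell2_pred : {pred I -> R[i]} := fun f => (sqsum f < +oo)%E.

Definition ell2_norm f : R := Num.sqrt (fine (sqsum f)).

Lemma sqsum_ge0 f : (0 <= sqsum f)%E.
Proof. by apply: esum_ge0 => i _; rewrite lee_fin sqr_ge0. Qed.

Lemma sqsum_fin f : f \in ell2_pred -> sqsum f \is a fin_num.
Proof. by move=> fl; rewrite ge0_fin_numE// sqsum_ge0. Qed.

Lemma esumZl (r : R) (a : I -> R) : 0 <= r -> 
  (\esum_(i in setT) (r * a i)%:E = r%:E * \esum_(i in setT) (a i)%:E)%E.
Proof.
move=> r0; rewrite /esum -ereal_supZl//; last first.
  by apply/set0P; eexists; exists set0 => //; exact: fsets_set0.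
congr ereal_sup; apply/seteqP.
split => [_ [X [fX _] <-]|_ [_ [X [fX _] <-] <-]].
  eexists; first by exists X.
  by rewrite !fsbig_finite//= !sumEFin -EFinM mulr_sumr.
exists X => //=.
by rewrite !fsbig_finite//= !sumEFin -EFinM mulr_sumr.
Qed.

Lemma sqsumZ c f : sqsum (c *: f) = ((normc c ^+ 2)%:E * sqsum f)%E.
Proof.
rewrite /sqsum -esumZl ?sqr_ge0//.
by apply: eq_esum => i _; rewrite normcM exprMn.
Qed.

Lemma normc_ge0 (c : R[i]) : 0 <= normc c.
Proof. by case: c => a b; exact: sqrtr_ge0. Qed.

(* For a suitable t, the sum of these inequalities gives Minkowski's. *)
Lemma sqr_le_weighted (t a b c : R) : 0 < t -> 0 <= a -> 0 <= b -> 0 <= c ->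
  c <= a + b -> c ^+ 2 <= (1 + t) * a ^+ 2 + (1 + t^-1) * b ^+ 2.
Proof.
move=> t0 a0 b0 c0 cab.
have : c ^+ 2 <= (a + b) ^+ 2 by rewrite ler_sqr ?nnegrE ?addr_ge0.
move=> /le_trans; apply; rewrite -subr_ge0.
have -> : (1 + t) * a ^+ 2 + (1 + t^-1) * b ^+ 2 - (a + b) ^+ 2 =
    t * (a - t^-1 * b) ^+ 2 by field; rewrite gt_eqF.
by rewrite mulr_ge0 ?sqr_ge0// ltW.
Qed.

Lemma sqsumD_le (t : R) f g : 0 < t ->
  (sqsum (f + g)%R <= (1 + t)%:E * sqsum f + (1 + t^-1)%:E * sqsum g)%E.
Proof.
move=> t0; have t'0 : 0 < t^-1 by rewrite invr_gt0.
rewrite /sqsum -!esumZl; [|lra|lra].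
rewrite -esumD => [|i _|i _]; first last.
- by rewrite lee_fin mulr_ge0 ?sqr_ge0//; lra.
- by rewrite lee_fin mulr_ge0 ?sqr_ge0//; lra.
apply: le_esum => i _; rewrite -EFinD lee_fin.
by apply: sqr_le_weighted; rewrite ?normc_ge0//; exact: le_normcD.
Qed.

Lemma ell2_pred_closed : submod_closed ell2_pred.
Proof.
split=> [|c f g fl gl].
  by rewrite unfold_in /ell2_pred /sqsum esum1// => i _; rewrite normc0 expr0n.
rewrite unfold_in /ell2_pred; apply: le_lt_trans (sqsumD_le _ _ ltr01) _.
rewrite sqsumZ -(fineK (sqsum_fin fl)) -(fineK (sqsum_fin gl)).
by rewrite -!EFinM -EFinD ltry.
Qed.

HB.instance Definition _ :=
  GRing.isSubmodClosed.Build _ _ ell2_pred ell2_pred_closed.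

Record ell2 : Type :=
  Ell2 { ell2_val :> I -> R[i]; _ : ell2_val \in ell2_pred }.
HB.instance Definition _ := [isSub for ell2_val].
HB.instance Definition _ := [Choice of ell2 by <:].
HB.instance Definition _ := [SubChoice_isSubLmodule of ell2 by <:].

Implicit Types x y : ell2.

Lemma ell2_normE x : (ell2_norm x ^+ 2)%:E = sqsum x.
Proof.
rewrite sqr_sqrtr ?fine_ge0 ?sqsum_ge0// fineK// sqsum_fin//.
exact: valP.
Qed.

Lemma ell2_normZ c x : ell2_norm (c *: x) = normc c * ell2_norm x.
Proof.
rewrite /ell2_norm [_ (c *: x)]/(c *: (x : I -> _)) sqsumZ fineM//; last first.
  by rewrite sqsum_fin// (valP x).
by rewrite sqrtrM ?sqr_ge0//= sqrtr_sqr ger0_norm// normc_ge0.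
Qed.

Lemma ell2_norm_eq0 x : ell2_norm x = 0 -> x = 0.
Proof.
move=> x0; apply: val_inj; apply/funext => i /=; apply: eq0_normc.
apply/eqP; rewrite -sqrf_eq0 eq_le sqr_ge0 andbT -lee_fin.
have x20 : sqsum x = 0%E by rewrite -ell2_normE x0 expr0n.
rewrite -[X in (_ <= X)%E]x20.
apply: esum_ge; exists [set i]; first by split=> //; exact: finite_set1.
by rewrite fsbig_set1.
Qed.

Lemma ler_ell2_normD x y :
  ell2_norm (x + y) <= ell2_norm x + ell2_norm y.
Proof.
have n0 (z : I -> R[i]) : 0 <= ell2_norm z by exact: sqrtr_ge0.
have [/eqP/ell2_norm_eq0 ->|xn0] := boolP (ell2_norm x == 0).
  by rewrite add0r ler_wpDl.
have [/eqP/ell2_norm_eq0 ->|yn0] := boolP (ell2_norm y == 0).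
  by rewrite addr0 ler_wpDr.
have xp : 0 < ell2_norm x by rewrite lt_def xn0 n0.
have yp : 0 < ell2_norm y by rewrite lt_def yn0 n0.
rewrite -ler_sqr ?nnegrE ?addr_ge0// -lee_fin ell2_normE.
apply: le_trans (sqsumD_le _ _ (divr_gt0 yp xp)) _.
rewrite -!ell2_normE -!EFinM -EFinD lee_fin le_eqVlt.
apply/orP; left; apply/eqP.
by field; rewrite xn0 yn0.
Qed.

Let norm x : R[i] := (ell2_norm x)%:C.

Let ler_normD x y : norm (x + y) <= norm x + norm y.
Proof. by rewrite -rmorphD lecR ler_ell2_normD. Qed.

Let normrZ c x : norm (c *: x) = `|c| * norm x.
Proof. by rewrite /norm ell2_normZ rmorphM. Qed.

Let normr0_eq0 x : norm x = 0 -> x = 0.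
Proof. by case=> /ell2_norm_eq0. Qed.

HB.instance Definition _ :=
  Lmodule_isNormed.Build R[i] ell2 ler_normD normrZ normr0_eq0.

End ell2.

(* The norm of a C*-algebra is such a norm; the ultrapower below depends only *)
(* on it and on the ring structure. It is not a normedModType structure: that *)
(* hierarchy has no join with rings below numDomainType.                      *)
Record ringNorm (R : realType) (A : pzRingType) : Type := RingNorm {
  rnorm :> A -> R ;
  ler_rnormD : forall x y, rnorm (x + y) <= rnorm x + rnorm y ;
  rnormN : forall x, rnorm (- x) = rnorm x ;
  rnorm0_eq0 : forall x, (rnorm x == 0) = (x == 0) ;
  ler_rnormM : forall x y, rnorm (x * y) <= rnorm x * rnorm y
}.

(* B(H), with composition as product and the operator norm. *)
Section BoundedOperators.
Variables (R : realType) (H : normedModType R[i]).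

Definition bop_pred : {pred H -> H} := fun f =>
  `[< linear f /\ exists M : R[i], forall x, `|f x| <= M * `|x| >].

Lemma bop_pred_closed : submod_closed bop_pred.
Proof.
split=> [|c f g /asboolP[flin [M fM]] /asboolP[glin [N gN]]].
  apply/asboolP; split=> [a x y|]; first by rewrite scaler0 addr0.
  by exists 0 => x; rewrite normr0 mul0r.
apply/asboolP; split=> [a x y|].
  rewrite -![(c *: f + g) _]/(c *: f _ + g _) flin glin.
  by rewrite !scalerDr !scalerA mulrC !addrA; congr (_ + _); rewrite addrAC.
exists (`|c| * M + N) => x.
rewrite -[(c *: f + g) x]/(c *: f x + g x) mulrDl -mulrA.
by rewrite (le_trans (ler_normD _ _))// lerD// normrZ ler_wpM2l.
Qed.

HB.instance Definition _ :=
  GRing.isSubmodClosed.Build _ _ bop_pred bop_pred_closed.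

Record bop : Type := Bop { bop_val :> H -> H; _ : bop_val \in bop_pred }.
HB.instance Definition _ := [isSub for bop_val].
HB.instance Definition _ := [Choice of bop by <:].
HB.instance Definition _ := [SubChoice_isSubLmodule of bop by <:].

Implicit Types S T U : bop.

Lemma bopP T : linear T. Proof. by have /asboolP[] := valP T. Qed.

Lemma bop_bounded T : exists M : R[i], forall x, `|T x| <= M * `|x|.
Proof. by have /asboolP[] := valP T. Qed.

Lemma bop_id_subproof : (fun x : H => x) \in bop_pred.
Proof. by apply/asboolP; split=> //; exists 1 => x; rewrite mul1r. Qed.

Lemma bop_comp_subproof S T : (fun x => S (T x)) \in bop_pred.
Proof.
apply/asboolP; split=> [a x y|]; first by rewrite !bopP.
have [M SM] := bop_bounded S; have [N TN] := bop_bounded T.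
exists (`|M| * N) => x; rewrite -mulrA (le_trans (SM _))//.
apply: (@le_trans _ _ (`|M| * `|T x|)); last by rewrite ler_wpM2l.
have [->|Tx0] := eqVneq (T x) 0; first by rewrite normr0 !mulr0.
rewrite ler_pM2r ?normr_gt0// real_ler_norm//.
have : 0 <= M * `|T x| by apply: le_trans (SM _).
by rewrite pmulr_lge0 ?normr_gt0//; exact: ger0_real.
Qed.

Definition bop_one : bop := Bop bop_id_subproof.
Definition bop_mul S T : bop := Bop (bop_comp_subproof S T).

Lemma bop_addE S T x : (S + T) x = S x + T x. Proof. by []. Qed.
Lemma bop_scaleE (c : R[i]) S x : (c *: S) x = c *: S x. Proof. by []. Qed.

Lemma bop_mulA : associative bop_mul.
Proof. by move=> S T U; apply: val_inj. Qed.
Lemma bop_mul1 : left_id bop_one bop_mul.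
Proof. by move=> S; apply: val_inj. Qed.
Lemma bop_mulr1 : right_id bop_one bop_mul.
Proof. by move=> S; apply: val_inj. Qed.
Lemma bop_mulDl : left_distributive bop_mul +%R.
Proof. by move=> S T U; apply: val_inj. Qed.
Lemma bopD T x y : T (x + y) = T x + T y.
Proof. by have := bopP T 1 x y; rewrite !scale1r. Qed.
Lemma bop0 T : T 0 = 0.
Proof. by apply: (addrI (T 0)); rewrite -bopD !addr0. Qed.
Lemma bopZ T c x : T (c *: x) = c *: T x.
Proof. by have := bopP T c x 0; rewrite bop0 !addr0. Qed.
Lemma bop_mulDr : right_distributive bop_mul +%R.
Proof.
by move=> S T U; apply: val_inj; apply/funext => x /=; exact: bopD.
Qed.

HB.instance Definition _ := GRing.Zmodule_isPzRing.Build bop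
  bop_mulA bop_mul1 bop_mulr1 bop_mulDl bop_mulDr.

Lemma bop_mulE S T x : (S * T) x = S (T x). Proof. by []. Qed.

Lemma bop_scalerAl (c : R[i]) S T : c *: (S * T) = (c *: S) * T.
Proof. exact: val_inj. Qed.

Lemma bop_scalerAr (c : R[i]) S T : c *: (S * T) = S * (c *: T).
Proof. by apply: val_inj; apply/funext => x; rewrite [RHS](bopZ S). Qed.

(* Norms of vectors are nonnegative reals inside R[i], whence Re. *)
Definition opnorm T : R :=
  sup [set complex.Re `|T x| | x in [set x | `|x| <= 1]].

Let normRe (x : H) : `|x| = (complex.Re `|x|)%:C.
Proof. by rewrite RRe_real// ger0_real. Qed.

Lemma opnorm_has_sup T :
  has_sup [set complex.Re `|T x| | x in [set x | `|x| <= 1]].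
Proof.
split; first by exists (complex.Re `|T 0|), 0 => //=; rewrite normr0.
have [M TM] := bop_bounded T; exists (complex.Re `|M|) => _ [x /= x1 <-].
have Mr : (complex.Re `|M|)%:C = `|M|.
  exact: RRe_real (ger0_real (normr_ge0 M)).
rewrite -lecR -normRe Mr.
apply: le_trans (TM x) _.
have [->|x0] := eqVneq x 0; first by rewrite normr0 mulr0.
apply: (@le_trans _ _ (`|M| * `|x|)); last by rewrite ler_piMr.
rewrite ler_pM2r ?normr_gt0// real_ler_norm//.
have : 0 <= M * `|x| by apply: le_trans (TM _).
by rewrite pmulr_lge0 ?normr_gt0//; exact: ger0_real.
Qed.

Lemma opnorm_ge0 T : 0 <= opnorm T.
Proof.
apply: sup_upper_bound (opnorm_has_sup T) _ _.
by exists 0 => /=; rewrite ?bop0 ?normr0.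
Qed.

Lemma le_opnorm T x : `|T x| <= (opnorm T)%:C * `|x|.
Proof.
have [->|x0] := eqVneq x 0; first by rewrite bop0 !normr0 mulr0.
rewrite -ler_pdivrMr ?normr_gt0//.
have -> : `|T x| / `|x| = `|T (`|x|^-1 *: x)|.
  by rewrite bopZ normrZ normfV normr_id mulrC.
rewrite normRe lecR; apply: sup_upper_bound (opnorm_has_sup T) _ _.
exists (`|x|^-1 *: x) => //=.
by rewrite normrZ normfV normr_id mulVf ?normr_eq0.
Qed.

Lemma opnorm_le T (M : R) : 0 <= M -> (forall x, `|T x| <= M%:C * `|x|) ->
  opnorm T <= M.
Proof.
move=> M0 TM; apply: ge_sup; first by case: (opnorm_has_sup T).
move=> _ [x /= x1 <-]; rewrite -lecR -normRe (le_trans (TM x))//.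
by rewrite ler_piMr// lecR.
Qed.

Let norm T : R[i] := (opnorm T)%:C.

Let bop_ler_normD S T : norm (S + T) <= norm S + norm T.
Proof.
rewrite -rmorphD lecR opnorm_le ?addr_ge0 ?opnorm_ge0// => x.
rewrite bop_addE (le_trans (ler_normD _ _))// rmorphD mulrDl.
by rewrite lerD ?le_opnorm.
Qed.

Lemma opnormZ_le (c : R[i]) T : opnorm (c *: T) <= normc c * opnorm T.
Proof.
rewrite opnorm_le ?mulr_ge0 ?opnorm_ge0 ?normc_ge0// => x.
by rewrite bop_scaleE normrZ rmorphM -mulrA ler_wpM2l// le_opnorm.
Qed.

Let bop_normrZ (c : R[i]) T : norm (c *: T) = `|c| * norm T.
Proof.
rewrite [`|c|](_ : _ = (normc c)%:C)// -rmorphM; congr (_%:C).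
apply/eqP; rewrite eq_le opnormZ_le/=.
have [->|c0] := eqVneq c 0; first by rewrite normc0 mul0r opnorm_ge0.
have nc0 : 0 < normc c.
  by rewrite lt_def normc_ge0 andbT; apply: contra c0 => /eqP/eq0_normc ->.
rewrite mulrC -ler_pdivlMr// mulrC -normcV.
by rewrite -{1}[T](scalerK c0) opnormZ_le.
Qed.

Let bop_normr0_eq0 T : norm T = 0 -> T = 0.
Proof.
move=> T0; apply: val_inj; apply/funext => x; apply/normr0_eq0/eqP.
by rewrite eq_le normr_ge0 andbT (le_trans (le_opnorm T x))// [_%:C]T0 mul0r.
Qed.

HB.instance Definition _ :=
  Lmodule_isNormed.Build R[i] bop bop_ler_normD bop_normrZ bop_normr0_eq0.

Lemma bop_normE T : `|T| = (opnorm T)%:C. Proof. by []. Qed.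

Let opnormD S T : opnorm (S + T) <= opnorm S + opnorm T.
Proof. by rewrite -lecR rmorphD; exact: bop_ler_normD. Qed.

Let opnormN T : opnorm (- T) = opnorm T.
Proof. by have := normrN T; rewrite !bop_normE => /complexI. Qed.

Let opnorm_eq0 T : (opnorm T == 0) = (T == 0).
Proof. by rewrite -[RHS]normr_eq0 bop_normE eq_complex/= eqxx andbT. Qed.

Let opnormM S T : opnorm (S * T) <= opnorm S * opnorm T.
Proof.
rewrite opnorm_le ?mulr_ge0 ?opnorm_ge0// => x.
rewrite bop_mulE (le_trans (le_opnorm _ _))// rmorphM -mulrA.
by rewrite ler_wpM2l ?le_opnorm// lecR opnorm_ge0.
Qed.

Definition bop_norm : ringNorm R bop :=
  RingNorm opnormD opnormN opnorm_eq0 opnormM.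

End BoundedOperators.

Section ReducedGroupAlgebra.
Variables (R : realType) (G : groupType).
Local Notation H := (ell2 R G).

Lemma sqsum_translate (g : G) (f : G -> R[i]) :
  sqsum (fun h => f (g^-1 * h)%g) = sqsum f.
Proof.
rewrite /sqsum [RHS](@reindex_esum R G G setT setT (fun h => g^-1 * h)%g)//.
split=> // [x y _ _|x _]; first exact: mulgI.
by exists (g * x)%g => //; rewrite mulKg.
Qed.

Lemma translate_subproof (g : G) (x : H) :
  (fun h => x (g^-1 * h)%g) \in @ell2_pred R G.
Proof. by rewrite unfold_in /ell2_pred sqsum_translate; exact: (valP x). Qed.

Definition translate (g : G) (x : H) : H := Ell2 (translate_subproof g x).

Lemma lreg_subproof (g : G) : translate g \in @bop_pred R H.
Proof.
apply/asboolP; split=> [a x y|]; first exact: val_inj.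
exists 1 => x; rewrite mul1r.
rewrite [leLHS](_ : _ = `|x|)//; congr ((Num.sqrt (fine _))%:C).
exact: sqsum_translate.
Qed.

Definition lreg (g : G) : bop H := Bop (lreg_subproof g).

Lemma lreg1 : lreg 1%g = 1.
Proof.
apply: val_inj; apply/funext => x; apply: val_inj; apply/funext => h /=.
by rewrite invg1 mul1g.
Qed.

Lemma lregM (g h : G) : lreg (g * h)%g = lreg g * lreg h.
Proof.
apply: val_inj; apply/funext => x; apply: val_inj; apply/funext => k /=.
by rewrite invgM mulgA.
Qed.

(* The image of the group algebra R[i][G] under the left regular              *)
(* representation.                                                            *)
Definition group_span : set (bop H) :=
  [set T | exists s : seq (R[i] * G), T = \sum_(p <- s) p.1 *: lreg p.2].

(* The closure is for the operator norm topology of B(l^2(G)). It is stable   *)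
(* under adjoints because lreg g^-1 is the adjoint of lreg g.                 *)
Definition cred_pred : {pred bop H} := fun T => `[< closure group_span T >].

Lemma cred_predP (T : bop H) : reflect
  (forall e : R, 0 < e -> exists2 S, group_span S & opnorm (T - S) < e)
  (T \in cred_pred).
Proof.
apply: (iffP (asboolP _)) => [clT e e0|approx B].
  have /clT[S [spS]] : nbhs T (ball T (e%:C)).
    by apply: nbhsx_ballx; rewrite ltcR.
  by rewrite -ball_normE/= bop_normE ltcR => TS; exists S.
rewrite -nbhs_ballE => -[e /= e0 TB].
have eE : (complex.Re e)%:C = e by rewrite RRe_real// gtr0_real.
have [|S spS TS] := approx (complex.Re e); first by rewrite -ltcR eE.
exists S; split=> //; apply: TB.
by rewrite -ball_normE /= bop_normE -eE ltcR.
Qed.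

Lemma group_span_lreg g : group_span (lreg g).
Proof. by exists [:: (1, g)]; rewrite big_seq1 scale1r. Qed.

Lemma group_spanD S T : group_span S -> group_span T -> group_span (S + T).
Proof. by move=> [s ->] [t ->]; exists (s ++ t); rewrite big_cat. Qed.

Lemma group_spanZ c T : group_span T -> group_span (c *: T).
Proof.
move=> [t ->]; exists [seq (c * p.1, p.2) | p <- t].
by rewrite big_map scaler_sumr; apply: eq_bigr => p _; rewrite scalerA.
Qed.

Lemma group_spanM S T : group_span S -> group_span T -> group_span (S * T).
Proof.
move=> [s ->] [t ->]; exists [seq (p.1 * q.1, (p.2 * q.2)%g) | p <- s, q <- t].
rewrite big_allpairs_dep mulr_suml; apply: eq_bigr => p _.
rewrite mulr_sumr; apply: eq_bigr => q _; rewrite lregM /=.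
by rewrite -bop_scalerAl -bop_scalerAr scalerA.
Qed.

Lemma sub_cred T : group_span T -> T \in cred_pred.
Proof. by move=> spT; apply/asboolP; exact: subset_closure. Qed.

Lemma cred_subring_closed : subring_closed cred_pred.
Proof.
split; first by rewrite -lreg1; exact/sub_cred/group_span_lreg.
- move=> S T /cred_predP clS /cred_predP clT; apply/cred_predP => e e0.
  have [|S' spS SS] := clS (e / 2); first by rewrite divr_gt0.
  have [|T' spT TT] := clT (e / 2); first by rewrite divr_gt0.
  exists (S' - T'); first by rewrite -scaleN1r; exact/group_spanD/group_spanZ.
  rewrite (_ : S - T - (S' - T') = (S - S') - (T - T')); last first.
    by rewrite !opprB addrACA [RHS]addrACA; congr (_ + _); rewrite addrC.
  apply: le_lt_trans (ler_rnormD (bop_norm _) _ _) _.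
  by rewrite rnormN [ltRHS]splitr ltrD.
- move=> S T /cred_predP clS /cred_predP clT; apply/cred_predP => e e0.
  pose s := opnorm S; pose t := opnorm T.
  have s0 : 0 <= s by exact: opnorm_ge0.
  have t0 : 0 <= t by exact: opnorm_ge0.
  have [|T' spT TT] := clT (e / 2 / (s + 1)).
    by rewrite !divr_gt0// ltr_wpDl.
  pose t' := opnorm T'; have t'0 : 0 <= t' by exact: opnorm_ge0.
  have [|S' spS SS] := clS (e / 2 / (t' + 1)).
    by rewrite !divr_gt0// ltr_wpDl.
  exists (S' * T'); first exact: group_spanM.
  rewrite (_ : _ - _ = S * (T - T') + (S - S') * T'); last first.
    by rewrite mulrBr mulrBl addrA subrK.
  apply: le_lt_trans (ler_rnormD (bop_norm _) _ _) _.
  rewrite [ltRHS]splitr ltrD//.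
    apply: le_lt_trans (ler_rnormM (bop_norm _) _ _) _.
    rewrite -[bop_norm _ S]/s -[bop_norm _ _]/(opnorm (T - T')).
    apply: (@le_lt_trans _ _ ((s + 1) * opnorm (T - T'))).
      by rewrite ler_wpM2r ?opnorm_ge0// lerDl.
    by rewrite mulrC -ltr_pdivlMr// ltr_wpDl.
  apply: le_lt_trans (ler_rnormM (bop_norm _) _ _) _.
  rewrite -[bop_norm _ T']/t' -[bop_norm _ _]/(opnorm (S - S')).
  apply: (@le_lt_trans _ _ (opnorm (S - S') * (t' + 1))).
    by rewrite ler_wpM2l ?opnorm_ge0// lerDl.
  by rewrite -ltr_pdivlMr// ltr_wpDl.
Qed.

HB.instance Definition _ :=
  @GRing.isSubringClosed.Build _ cred_pred cred_subring_closed.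

Record reduced_cstar : Type :=
  ReducedCstar { cred_val :> bop H; _ : cred_val \in cred_pred }.
HB.instance Definition _ := [isSub for cred_val].
HB.instance Definition _ := [Choice of reduced_cstar by <:].
HB.instance Definition _ := GRing.SubChoice_isSubPzRing.Build _ _ reduced_cstar
  (subringClosedP cred_pred).

Let credD (x y : reduced_cstar) :
  opnorm (cred_val (x + y)) <= opnorm x + opnorm y.
Proof. exact: (ler_rnormD (bop_norm _)). Qed.
Let credN (x : reduced_cstar) : opnorm (cred_val (- x)) = opnorm x.
Proof. exact: (rnormN (bop_norm _)). Qed.
Let cred_eq0 (x : reduced_cstar) : (opnorm x == 0) = (x == 0).
Proof. exact: (rnorm0_eq0 (bop_norm _)). Qed.
Let credM (x y : reduced_cstar) :
  opnorm (cred_val (x * y)) <= opnorm x * opnorm y.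
Proof. exact: (ler_rnormM (bop_norm _)). Qed.

Definition cred_norm : ringNorm R reduced_cstar :=
  RingNorm credD credN cred_eq0 credM.

End ReducedGroupAlgebra.

Record freeUltrafilter (T : Type) : Type := FreeUltrafilter {
  ultraset :> set_system T ;
  ultrasetP : UltraFilter ultraset ;
  ultraset_free : \bigcap_(X in ultraset) X = set0
}.

(* The norm ultrapower of a normed ring along a free ultrafilter on nat. *)
Section Ultrapower.
Variables (R : realType) (A : pzRingType) (N : ringNorm R A).

Lemma rnorm0 : N 0 = 0. Proof. by apply/eqP; rewrite rnorm0_eq0. Qed.

Lemma rnorm_ge0 a : 0 <= N a.
Proof.
have := ler_rnormD N a (- a); rewrite subrr rnorm0 rnormN -mulr2n.
by rewrite pmulrn_lge0.
Qed.

Definition ellinf_pred : {pred nat -> A} := fun a =>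
  `[< exists M : R, forall k, N (a k) <= M >].

Lemma ellinf_subring_closed : subring_closed ellinf_pred.
Proof.
split; first by apply/asboolP; exists (N 1) => k.
- move=> a b /asboolP[M aM] /asboolP[L bL]; apply/asboolP; exists (M + L) => k.
  by apply: le_trans (ler_rnormD N _ _) _; rewrite rnormN lerD.
- move=> a b /asboolP[M aM] /asboolP[L bL]; apply/asboolP; exists (M * L) => k.
  by apply: le_trans (ler_rnormM N _ _) _; rewrite ler_pM// rnorm_ge0.
Qed.

HB.instance Definition _ :=
  GRing.isSubringClosed.Build _ ellinf_pred ellinf_subring_closed.

Record ellinf : Type :=
  Ellinf { ellinf_val :> nat -> A; _ : ellinf_val \in ellinf_pred }.
HB.instance Definition _ := [isSub for ellinf_val].
HB.instance Definition _ := [Choice of ellinf by <:].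
HB.instance Definition _ := GRing.SubChoice_isSubPzRing.Build _ _ ellinf
  (subringClosedP ellinf_pred).

Variable w : freeUltrafilter nat.
Let w_proper : ProperFilter (ultraset w) := @ultra_proper _ _ (ultrasetP w).
#[local] Existing Instance w_proper.

Definition comega_pred : {pred ellinf} := fun a =>
  `[< N (a k) @[k --> ultraset w] --> (0 : R) >].

Lemma comega_zmod_closed : zmod_closed comega_pred.
Proof.
split=> [|a b /asboolP aw /asboolP bw]; apply/asboolP.
  by under eq_fun do rewrite rnorm0; exact: cvg_cst.
apply: (@squeeze_cvgr _ _ _ _ (fun=> 0) (fun k => N (a k) + N (b k))).
- apply: nearW => k; rewrite rnorm_ge0/=.
  by apply: le_trans (ler_rnormD N _ _) _; rewrite rnormN.
- exact: cvg_cst.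
- by rewrite -[0 in X in _ --> X](addr0 0); exact: cvgD.
Qed.

HB.instance Definition _ :=
  GRing.isZmodClosed.Build _ comega_pred comega_zmod_closed.

Lemma comegaMl (a b : ellinf) : b \in comega_pred -> a * b \in comega_pred.
Proof.
move=> /asboolP bw; have /asboolP[M aM] := valP a; apply/asboolP.
apply: (@squeeze_cvgr _ _ _ _ (fun=> 0) (fun k => M * N (b k))).
- apply: nearW => k; rewrite rnorm_ge0/=.
  by apply: le_trans (ler_rnormM N _ _) _; rewrite ler_wpM2r ?rnorm_ge0.
- exact: cvg_cst.
- by rewrite -[0 in X in _ --> X](mulr0 M); exact: cvgMr.
Qed.

Lemma comegaMr (a b : ellinf) : a \in comega_pred -> a * b \in comega_pred.
Proof.
move=> /asboolP aw; have /asboolP[M bM] := valP b; apply/asboolP.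
apply: (@squeeze_cvgr _ _ _ _ (fun=> 0) (fun k => N (a k) * M)).
- apply: nearW => k; rewrite rnorm_ge0/=.
  by apply: le_trans (ler_rnormM N _ _) _; rewrite ler_wpM2l ?rnorm_ge0.
- exact: cvg_cst.
- by rewrite -[0 in X in _ --> X](mul0r M); exact: cvgMl.
Qed.

Local Open Scope quotient_scope.

Definition ultrapower : Type := Quotient.quot comega_pred.
HB.instance Definition _ := GRing.Zmodule.on ultrapower.
HB.instance Definition _ :
    EqQuotient ellinf (Quotient.equiv comega_pred) ultrapower :=
  EqQuotient.on ultrapower.

Definition ultrapower_one : ultrapower := \pi_ultrapower 1.
Definition ultrapower_mul := lift_op2 ultrapower *%R.

Lemma pi_ultrapowerP (a b : ellinf) :
  \pi_ultrapower a = \pi_ultrapower b <-> a - b \in comega_pred.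
Proof. by rewrite (Quotient.idealrBE comega_pred); split => /eqP. Qed.

Lemma pi_ultrapower_mul (a b : ellinf) :
  \pi_ultrapower (a * b) =
  ultrapower_mul (\pi_ultrapower a) (\pi_ultrapower b).
Proof.
unlock ultrapower_mul; apply/pi_ultrapowerP; set a' := repr _; set b' := repr _.
have aa' : a - a' \in comega_pred by apply/pi_ultrapowerP; rewrite reprK.
have bb' : b - b' \in comega_pred by apply/pi_ultrapowerP; rewrite reprK.
have -> : a * b - a' * b' = a * (b - b') + (a - a') * b'.
  by rewrite mulrBr mulrBl addrA subrK.
by apply: rpredD; [exact: comegaMl|exact: comegaMr].
Qed.

Lemma pi_ultrapowerD (a b : ellinf) :
  \pi_ultrapower (a + b) = \pi_ultrapower a + \pi_ultrapower b.
Proof. exact: (Quotient.pi_add comega_pred). Qed.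

Lemma ultrapower_mulA : associative ultrapower_mul.
Proof.
move=> x y z; rewrite -[x]reprK -[y]reprK -[z]reprK.
by rewrite -!pi_ultrapower_mul mulrA.
Qed.

Lemma ultrapower_mul1 : left_id ultrapower_one ultrapower_mul.
Proof. by move=> x; rewrite -[x]reprK -pi_ultrapower_mul mul1r. Qed.

Lemma ultrapower_mulr1 : right_id ultrapower_one ultrapower_mul.
Proof. by move=> x; rewrite -[x]reprK -pi_ultrapower_mul mulr1. Qed.

Lemma ultrapower_mulDl : left_distributive ultrapower_mul +%R.
Proof.
move=> x y z; rewrite -[x]reprK -[y]reprK -[z]reprK.
by rewrite -pi_ultrapowerD -!pi_ultrapower_mul -pi_ultrapowerD mulrDl.
Qed.

Lemma ultrapower_mulDr : right_distributive ultrapower_mul +%R.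
Proof.
move=> x y z; rewrite -[x]reprK -[y]reprK -[z]reprK.
by rewrite -pi_ultrapowerD -!pi_ultrapower_mul -pi_ultrapowerD mulrDr.
Qed.

HB.instance Definition _ := GRing.Zmodule_isPzRing.Build ultrapower
  ultrapower_mulA ultrapower_mul1 ultrapower_mulr1
  ultrapower_mulDl ultrapower_mulDr.

Lemma pi_ultrapowerM (a b : ellinf) :
  \pi_ultrapower (a * b) = \pi_ultrapower a * \pi_ultrapower b.
Proof. exact: pi_ultrapower_mul. Qed.

Lemma const_subproof (x : A) : (fun=> x) \in ellinf_pred.
Proof. by apply/asboolP; exists (N x). Qed.

Definition diag (x : A) : ultrapower :=
  \pi_ultrapower (Ellinf (const_subproof x)).

(* The relative commutant of A, embedded by diag, in its ultrapower. *)
Definition central_sequence_algebra : set ultrapower :=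
  [set x | forall a : A, x * diag a = diag a * x].

End Ultrapower.

Arguments cred_norm : clear implicits.
Arguments ellinf {R A} N.
Arguments ultrapower {R A} N w.
Arguments diag {R A} N w x.
Arguments central_sequence_algebra {R A} N w _.

(* Main.v *)
Require Import Defs.
From mathcomp Require Import all_boot all_order all_algebra.
From mathcomp Require Import all_classical all_reals all_analysis.
From mathcomp Require Import complex generic_quotient ring_quotient.
From mathcomp Require Import ring lra zify.
Set Implicit Arguments.
Unset Strict Implicit.
Unset Printing Implicit Defensive.
Import Order.TTheory GRing.Theory Num.Theory.
Import numFieldNormedType.Exports.
Import Normc.
Local Open Scope ring_scope.

(** The proof exhibits two central sequences that do not commute, both with
    terms in the group algebra. Write [avg q u] for the mean of the
    translations by [u ^+ j], 1 <= j <= q^2: a contraction that nearly fixes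
    the indicators of long orbits of [u]. If the positive powers of [u] map the
    complement of a set [D] into [D], then [avg q u] has norm at most 1/q on
    vectors supported off [D], and so does the part of its range off [D]; up to
    2/q it acts inside l^2(D). Hence, when [x] runs over a finite set [X] for
    which the translates [x D] are disjoint, a combination sum_x c(x) x (avg q
    u) x^-1 is block diagonal up to small terms, and its norm is at most max
    |c| (1 + 2 #|X| / q) ([opnorm_sum_avg_le]).

    Now take for [c] a tent function of height 1 on the ball of radius k in the
    free group. Conjugation by [g] translates [c], which changes it by at most
    |g|/(k+1); by the norm bound applied to the difference, the sums T_k form a
    central sequence ([central_op_commutator]). The same holds for the sums
    T'_k built from (avg q u) v, provided that the sets [x v^-1 D] are disjoint
    too.

    These do not commute: let xi be the sum of the point masses at [v^-1 u ^+
    i], for i up to 8 q^2. All coefficients being nonnegative, T_k T'_k xi is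
    at least (avg q u)^2 (v xi), which is 1 at three quarters of the points [u
    ^+ i], while xi is supported off every [x D], so that T_k xi is small. This
    keeps the norm of the commutator above 1/2 ([central_op_noncommuting]).

    Such [u], [v], [D] exist for every radius: with two generators a, b and m
    larger than 4k, let u = (a^m b^m)^2, v^-1 = b^m a^m, and let [D] be the set
    of the words that begin with a^m b^m or with its inverse. A nontrivial left
    factor of length less than m moves the place where the letter changes or
    spoils the first block ([starts_shift]); this gives the disjointness of the
    translates. *)

(** * Orthogonality in l^2 *)

Section SquareSummable.
Variables (R : realType) (I : choiceType).
Implicit Types (x y : ell2 R I) (D : pred I).

Lemma ell2_norm_ge0 x : 0 <= ell2_norm x. Proof. exact: sqrtr_ge0. Qed.

Lemma ell2_ext x y : (forall i, x i = y i) -> x = y.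
Proof. by move=> xy; apply/val_inj/funext. Qed.

Lemma ell2_norm0 : ell2_norm (0 : ell2 R I) = 0.
Proof. by have := ell2_normZ 0 (0 : ell2 R I); rewrite scale0r normc0 mul0r. Qed.

Lemma ell2_sumE (J : Type) (r : seq J) (y : J -> ell2 R I) i :
  (\sum_(j <- r) y j) i = \sum_(j <- r) y j i.
Proof. exact: (big_morph (fun x : ell2 R I => x i)). Qed.

Lemma ell2_norm_sum_le (J : eqType) (r : seq J) (y : J -> ell2 R I) (a : J -> R) :
  (forall j, j \in r -> ell2_norm (y j) <= a j) ->
  ell2_norm (\sum_(j <- r) y j) <= \sum_(j <- r) a j.
Proof.
elim: r => [_|j r IHr ya]; first by rewrite !big_nil ell2_norm0.
rewrite !big_cons; apply: le_trans (ler_ell2_normD _ _) _.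
by apply: lerD; [rewrite ya ?mem_head|apply: IHr => k kr; rewrite ya// inE kr orbT].
Qed.

Lemma normc_real_ge0 (c : R) : 0 <= c -> normc c%:C%C = c.
Proof. by move=> c0; rewrite /normc /= expr0n addr0 sqrtr_sqr ger0_norm. Qed.

Lemma le_ell2_norm x y :
  (forall i, normc (x i) <= normc (y i)) -> ell2_norm x <= ell2_norm y.
Proof.
move=> xy; rewrite -ler_sqr ?nnegrE ?ell2_norm_ge0// -lee_fin !ell2_normE.
by apply: le_esum => i _; rewrite lee_fin ler_sqr ?nnegrE ?normc_ge0.
Qed.

Lemma ell2_normsq_ge x (s : seq I) : uniq s ->
  \sum_(i <- s) normc (x i) ^+ 2 <= ell2_norm x ^+ 2.
Proof.
move=> us; rewrite -lee_fin ell2_normE; apply: esum_ge.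
exists [set` s]%classic; first by split=> //; exact: finite_seq.
by rewrite -fsbig_seq// sumEFin.
Qed.

Definition disjoint_family (J : eqType) (r : seq J) (D : J -> pred I) :=
  forall j k i, j \in r -> k \in r -> D j i -> D k i -> j = k.

Lemma normc_sum_disjoint (J : eqType) (r : seq J) (D : J -> pred I)
    (c : J -> R[i]) i :
  uniq r -> disjoint_family r D -> (forall j, j \in r -> ~~ D j i -> c j = 0) ->
  normc (\sum_(j <- r) c j) ^+ 2 = \sum_(j <- r) normc (c j) ^+ 2.
Proof.
move=> ur dD c0; have [/hasP[j jr Dj]|/hasPn nD] := boolP (has (fun j => D j i) r).
  rewrite (bigD1_seq j)//= [X in _ + X]big_seq_cond big1 ?addr0.
    rewrite (bigD1_seq j)//= [X in _ + X]big_seq_cond big1 ?addr0// => k.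
    case/andP=> kr kj; rewrite c0 ?normc0 ?expr0n//.
    by apply: contraNN kj => Dk; rewrite (dD k j i).
  move=> k /andP[kr kj]; rewrite c0//.
  by apply: contraNN kj => Dk; rewrite (dD k j i).
rewrite !big_seq !big1 ?normc0 ?expr0n// => j jr; rewrite c0 ?nD//.
by rewrite normc0 expr0n.
Qed.

(** Pythagoras: vectors with disjoint supports are orthogonal. *)
Lemma ell2_normsq_sum (J : choiceType) (r : seq J) (D : J -> pred I)
    (y : J -> ell2 R I) :
  uniq r -> disjoint_family r D ->
  (forall j i, j \in r -> ~~ D j i -> y j i = 0) ->
  ell2_norm (\sum_(j <- r) y j) ^+ 2 = \sum_(j <- r) ell2_norm (y j) ^+ 2.
Proof.
move=> ur dD y0; apply: EFin_inj; rewrite ell2_normE -sumEFin.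
under [RHS]eq_bigr do rewrite ell2_normE.
rewrite -esum_sum; last by move=> i j _ _; rewrite lee_fin sqr_ge0.
apply: eq_esum => i _; rewrite sumEFin; congr EFin.
rewrite ell2_sumE (normc_sum_disjoint (i := i) ur dD)// => j jr Dj; exact: y0.
Qed.

Lemma cutoff_subproof D x :
  (fun i => if D i then x i else 0) \in @ell2_pred R I.
Proof.
rewrite unfold_in /ell2_pred; apply: le_lt_trans (valP x).
apply: le_esum => i _; rewrite lee_fin; case: (D i) => //.
by rewrite normc0 expr0n/= sqr_ge0.
Qed.

(** The orthogonal projection onto the vectors supported in [D]. *)
Definition cutoff D x : ell2 R I := Ell2 (cutoff_subproof D x).

Lemma cutoffE D x i : cutoff D x i = if D i then x i else 0.
Proof. by []. Qed.

Lemma cutoffC D x : x = cutoff D x + cutoff (predC D) x.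
Proof.
apply: ell2_ext => i; rewrite /= /(_ + _)/=.
by case: (D i); rewrite ?addr0 ?add0r.
Qed.

Lemma ell2_norm_cutoff D x : ell2_norm (cutoff D x) <= ell2_norm x.
Proof.
apply: le_ell2_norm => i; rewrite cutoffE.
by case: (D i) => //; rewrite normc0 normc_ge0.
Qed.

Lemma cutoff_sum D (J : Type) (r : seq J) (y : J -> ell2 R I) :
  cutoff D (\sum_(j <- r) y j) = \sum_(j <- r) cutoff D (y j).
Proof.
apply: ell2_ext => i; rewrite [LHS]cutoffE [RHS]ell2_sumE.
case Di: (D i); last by rewrite big1// => j _; rewrite cutoffE Di.
by rewrite ell2_sumE; apply: eq_bigr => j _; rewrite cutoffE Di.
Qed.

Lemma cutoffZ D c x : cutoff D (c *: x) = c *: cutoff D x.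
Proof.
apply: ell2_ext => i; rewrite cutoffE.
rewrite [LHS](_ : _ = if D i then c * x i else 0)//.
rewrite [RHS](_ : _ = c * cutoff D x i)// cutoffE.
by case: (D i); rewrite ?mulr0.
Qed.

(** Bessel: the cutoffions of a vector to disjoint sets are orthogonal. *)
Lemma sum_ell2_normsq_cutoff (J : choiceType) (r : seq J) (D : J -> pred I) x :
  uniq r -> disjoint_family r D ->
  \sum_(j <- r) ell2_norm (cutoff (D j) x) ^+ 2 <= ell2_norm x ^+ 2.
Proof.
move=> ur dD; rewrite -(ell2_normsq_sum ur dD) => [|j i _ /negPf Dji]; last first.
  by rewrite cutoffE Dji.
rewrite ler_sqr ?nnegrE ?ell2_norm_ge0//; apply: le_ell2_norm => i.
rewrite -ler_sqr ?nnegrE ?normc_ge0//.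
rewrite ell2_sumE (normc_sum_disjoint (i := i) ur dD) => [|j _ /negPf Dji]; last first.
  by rewrite cutoffE Dji.
have [/hasP[j jr Dj]|/hasPn nD] := boolP (has (fun j => D j i) r).
  rewrite (bigD1_seq j)//= [X in _ + X]big_seq_cond big1 ?addr0.
    by rewrite Dj.
  move=> k /andP[kr kj]; rewrite ifF ?normc0 ?expr0n//.
  by apply: contraNF kj => Dk; rewrite (dD k j i).
rewrite big_seq big1 ?sqr_ge0// => j jr.
by rewrite cutoffE (negPf (nD j jr)) normc0 expr0n.
Qed.

End SquareSummable.

(** * Averages of translations *)

Section AveragedTranslations.
Variables (R : realType) (G : groupType).
Local Notation H := (ell2 R G).
Implicit Types (x y : H) (g h u : G) (S T : bop H) (D : pred G).

Lemma lregE g x h : lreg R g x h = x (g^-1 * h)%g. Proof. by []. Qed.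

Lemma ell2_norm_lreg g x : ell2_norm (lreg R g x) = ell2_norm x.
Proof. by congr (Num.sqrt (fine _)); exact: sqsum_translate. Qed.

Lemma cutoff_lreg D g x :
  cutoff D (lreg R g x) = lreg R g (cutoff (fun h => D (g * h)%g) x).
Proof. by apply: ell2_ext => h; rewrite cutoffE !lregE cutoffE mulVKg. Qed.

Lemma expgn_conj g u j : ((g * u * g^-1) ^+ j = g * u ^+ j * g^-1)%g.
Proof.
elim: j => [|j IHj]; first by rewrite !expg0 mulg1 mulgV.
by rewrite !expgS IHj !mulgA mulgVK.
Qed.

Lemma lregVK g : lreg R g^-1%g * lreg R g = 1.
Proof. by rewrite -Defs.lregM mulVg Defs.lreg1. Qed.

Lemma bop_sumE (J : Type) (r : seq J) (T : J -> bop H) x :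
  (\sum_(j <- r) T j) x = \sum_(j <- r) T j x.
Proof. exact: (big_morph (fun T : bop H => T x)). Qed.

Lemma bop_scale_at c T x g : (c *: T) x g = c * T x g. Proof. by []. Qed.

Lemma ell2_norm_opnorm T x : ell2_norm (T x) <= opnorm T * ell2_norm x.
Proof. by have := le_opnorm T x; rewrite -rmorphM lecR. Qed.

Lemma opnorm_le_ell2 T (M : R) : 0 <= M ->
  (forall x, ell2_norm (T x) <= M * ell2_norm x) -> opnorm T <= M.
Proof.
by move=> M0 TM; apply: opnorm_le => // x; rewrite -rmorphM lecR.
Qed.

Lemma opnormD S T : opnorm (S + T) <= opnorm S + opnorm T.
Proof. exact: (ler_rnormD (bop_norm _)). Qed.

Lemma opnormM S T : opnorm (S * T) <= opnorm S * opnorm T.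
Proof. exact: (ler_rnormM (bop_norm _)). Qed.

Lemma opnorm0 : opnorm (0 : bop H) = 0.
Proof. exact: (rnorm0 (bop_norm _)). Qed.

Lemma opnormN T : opnorm (- T) = opnorm T.
Proof. exact: (rnormN (bop_norm _)). Qed.

Lemma group_span_sum (J : Type) (r : seq J) (T : J -> bop H) :
  (forall j, group_span (T j)) -> group_span (\sum_(j <- r) T j).
Proof.
move=> spT; elim: r => [|j r IHr]; first by exists [::]; rewrite !big_nil.
by rewrite big_cons; apply: group_spanD.
Qed.

Lemma opnorm_lreg_le g : opnorm (lreg R g) <= 1.
Proof. by apply: opnorm_le_ell2 => // x; rewrite ell2_norm_lreg mul1r. Qed.

(** An average over [q ^ 2] powers, so that the bounds below involve [q] and no
    square root. *)
Definition avg (q : nat) u : bop H :=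
  ((q%:R ^+ 2)^-1 : R)%:C%C *: \sum_(j <- iota 1 (q ^ 2)) lreg R (u ^+ j)%g.

Lemma avgE q u x :
  avg q u x = ((q%:R ^+ 2)^-1 : R)%:C%C *:
    \sum_(j <- iota 1 (q ^ 2)) lreg R (u ^+ j)%g x.
Proof. by rewrite /avg bop_scaleE bop_sumE. Qed.

Lemma avg_conj q g u : lreg R g * avg q u * lreg R g^-1 = avg q (g * u * g^-1)%g.
Proof.
rewrite /avg -bop_scalerAr -bop_scalerAl mulr_sumr mulr_suml; congr (_ *: _).
apply: eq_bigr => j _.
by rewrite expgn_conj !Defs.lregM.
Qed.

Lemma sqr_sum_le (J : Type) (r : seq J) (a : J -> R) :
  (\sum_(j <- r) a j) ^+ 2 <= (size r)%:R * \sum_(j <- r) a j ^+ 2.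
Proof.
elim: r => [|j r IHr]; first by rewrite !big_nil expr0n mul0r.
rewrite !big_cons /= -[(size r).+1%:R]natr1.
have : 2 * a j * (\sum_(k <- r) a k) <=
    (size r)%:R * a j ^+ 2 + \sum_(k <- r) a k ^+ 2.
  elim: r {IHr} => [|k r IHr]; first by rewrite !big_nil mulr0 mul0r addr0.
  rewrite !big_cons /= -[(size r).+1%:R]natr1; have := sqr_ge0 (a j - a k); nra.
lra.
Qed.

(** The ping-pong condition; the negative powers of [u] then satisfy it too. *)
Definition absorbs u D := forall j g, (0 < j)%N -> ~~ D g -> D (u ^+ j * g)%g.

Lemma ell2_norm_avg q u x : (0 < q)%N -> ell2_norm (avg q u x) <= ell2_norm x.
Proof.
move=> q0; have q0' : 0 < q%:R :> R by rewrite ltr0n.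
rewrite avgE ell2_normZ normc_real_ge0 ?invr_ge0 ?sqr_ge0//.
rewrite ler_pdivrMl ?exprn_gt0//.
apply: (@le_trans _ _ (\sum_(j <- iota 1 (q ^ 2)) ell2_norm x)).
  by apply: ell2_norm_sum_le => j _; rewrite ell2_norm_lreg.
by rewrite big_const_seq count_predT size_iota iter_addr_0 -[_ *+ (q ^ 2)]mulr_natl natrX.
Qed.

Lemma absorbs_lt u D j k g : absorbs u D -> (j < k)%N ->
  ~~ D (u ^+ j * g)%g -> D (u ^+ k * g)%g.
Proof.
move=> aD jk Dg; rewrite -(subnK (ltnW jk)) expgnDr -mulgA.
by apply: aD => //; rewrite subn_gt0.
Qed.

Lemma absorbs_ltV u D j k g : absorbs u D -> (j < k)%N ->
  ~~ D ((u ^+ k)^-1 * g)%g -> D ((u ^+ j)^-1 * g)%g.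
Proof.
move=> aD jk; rewrite -(subnKC (ltnW jk)) expgnDr invgM -mulgA => Dg.
by rewrite -(mulVKg (u ^+ (k - j))%g (_ * g)%g) aD ?subn_gt0.
Qed.

(** The translates of the complement of [D] by the positive powers of [u] are
    disjoint, so that the [q ^ 2] terms of the average are orthogonal. *)
Lemma ell2_norm_avg_off q u D x : (0 < q)%N -> absorbs u D ->
  (forall g, D g -> x g = 0) -> ell2_norm (avg q u x) <= q%:R^-1 * ell2_norm x.
Proof.
move=> q0 aD x0; have q0' : 0 < q%:R :> R by rewrite ltr0n.
rewrite avgE ell2_normZ normc_real_ge0 ?invr_ge0 ?sqr_ge0//.
rewrite ler_pdivrMl ?exprn_gt0// mulrA expr2 mulfK ?gt_eqF//.
rewrite -ler_sqr ?nnegrE ?mulr_ge0 ?ell2_norm_ge0 ?(ltW q0')//.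
rewrite (@ell2_normsq_sum _ _ _ _ (fun j g => ~~ D ((u ^+ j)^-1 * g)%g)).
- under eq_bigr do rewrite ell2_norm_lreg.
  rewrite big_const_seq count_predT size_iota iter_addr_0 -[_ *+ (q ^ 2)]mulr_natl natrX.
  by rewrite exprMn.
- exact: iota_uniq.
- move=> j k g _ _; wlog jk : j k / (j < k)%N => [ih Dj Dk|Dj Dk].
    have [jk|kj|//] := ltngtP j k; first exact: (ih j k).
    by apply/esym; exact: (ih k j).
  by have := absorbs_ltV aD jk Dk; rewrite (negPf Dj).
- by move=> j g _; rewrite negbK => Dg; rewrite lregE x0.
Qed.

(** Dual to the previous estimate: the value of the average off [D] depends,
    term by term, on disjoint pieces of the vector. *)
Lemma ell2_norm_avg_compl q u D x : (0 < q)%N -> absorbs u D ->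
  ell2_norm (cutoff (predC D) (avg q u x)) <= q%:R^-1 * ell2_norm x.
Proof.
move=> q0 aD; have q0' : 0 < q%:R :> R by rewrite ltr0n.
rewrite avgE cutoffZ ell2_normZ normc_real_ge0 ?invr_ge0 ?sqr_ge0//.
rewrite ler_pdivrMl ?exprn_gt0// mulrA expr2 mulfK ?gt_eqF//.
rewrite cutoff_sum.
pose a j := ell2_norm (cutoff (fun h => ~~ D (u ^+ j * h)%g) x).
apply: (@le_trans _ _ (\sum_(j <- iota 1 (q ^ 2)) a j)).
  by apply: ell2_norm_sum_le => j _; rewrite cutoff_lreg ell2_norm_lreg.
rewrite -ler_sqr ?nnegrE ?mulr_ge0 ?sumr_ge0 ?ell2_norm_ge0 ?(ltW q0')//; last first.
  by move=> j _; exact: ell2_norm_ge0.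
apply: le_trans (sqr_sum_le _ _) _.
rewrite size_iota exprMn natrX ler_wpM2l ?sqr_ge0//.
apply: (sum_ell2_normsq_cutoff (D := fun j h => ~~ D (u ^+ j * h)%g)).
  exact: iota_uniq.
move=> j k g _ _; wlog jk : j k / (j < k)%N => [ih Dj Dk|Dj Dk].
  have [jk|kj|//] := ltngtP j k; first exact: (ih j k).
  by apply/esym; exact: (ih k j).
by have := absorbs_lt aD jk Dj; rewrite (negPf Dk).
Qed.

(** Each summand is split along [D j] and its complement. The part that maps
    l^2(D j) to itself gives a block-diagonal sum, of norm at most [C]; the two
    other parts of each summand have norm at most [C / q]. *)
Lemma opnorm_sum_avg_le (J : choiceType) (r : seq J) (c : J -> R)
    (D : J -> pred G) (u t : J -> G) (q : nat) (C : R) :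
  (0 < q)%N -> 0 <= C -> uniq r -> (forall j, j \in r -> `|c j| <= C) ->
  (forall j, j \in r -> absorbs (u j) (D j)) ->
  disjoint_family r D -> disjoint_family r (fun j g => D j (t j * g)%g) ->
  opnorm (\sum_(j <- r) (c j)%:C%C *: (avg q (u j) * lreg R (t j))) <=
    C * (1 + 2 * (size r)%:R / q%:R).
Proof.
move=> q0 C0 ur cC aD dD dE; have q0' : 0 < q%:R :> R by rewrite ltr0n.
have normc_c j : j \in r -> normc (c j)%:C%C <= C.
  by move=> /cC; rewrite /normc /= expr0n addr0 sqrtr_sqr.
apply: opnorm_le_ell2 => [|x].
  by rewrite mulr_ge0// addr_ge0// divr_ge0 ?mulr_ge0 ?ler0n.
pose y j := lreg R (t j) x.
pose p j := cutoff (D j) (y j).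
have py j : ell2_norm (p j) = ell2_norm (cutoff (fun g => D j (t j * g)%g) x).
  by rewrite /p cutoff_lreg ell2_norm_lreg.
have -> : (\sum_(j <- r) (c j)%:C%C *: (avg q (u j) * lreg R (t j))) x =
    \sum_(j <- r) (c j)%:C%C *: cutoff (D j) (avg q (u j) (p j)) +
    (\sum_(j <- r) (c j)%:C%C *: cutoff (predC (D j)) (avg q (u j) (p j)) +
     \sum_(j <- r) (c j)%:C%C *: avg q (u j) (cutoff (predC (D j)) (y j))).
  rewrite bop_sumE -!big_split /=; apply: eq_bigr => j _.
  rewrite [LHS](_ : _ = (c j)%:C%C *: avg q (u j) (y j))// -!scalerDr.
  rewrite addrA -cutoffC; congr (_ *: _).
  rewrite [LHS](congr1 (avg q (u j)) (cutoffC (D j) (y j))); exact: bopD.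
have small (z : J -> H) :
    (forall j, j \in r -> ell2_norm (z j) <= q%:R^-1 * ell2_norm x) ->
    ell2_norm (\sum_(j <- r) (c j)%:C%C *: z j) <=
      C * ((size r)%:R / q%:R) * ell2_norm x.
  move=> zx.
  have -> : C * ((size r)%:R / q%:R) * ell2_norm x =
      \sum_(j <- r) C * (q%:R^-1 * ell2_norm x).
    rewrite big_const_seq count_predT iter_addr_0 -[_ *+ size r]mulr_natl.
    by field; rewrite gt_eqF.
  apply: ell2_norm_sum_le => j jr; rewrite ell2_normZ.
  by apply: ler_pM; rewrite ?normc_ge0 ?ell2_norm_ge0 ?normc_c ?zx.
have -> : C * (1 + 2 * (size r)%:R / q%:R) * ell2_norm x = C * ell2_norm x +
    (C * ((size r)%:R / q%:R) * ell2_norm x +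
     C * ((size r)%:R / q%:R) * ell2_norm x) by field; rewrite gt_eqF.
apply: le_trans (ler_ell2_normD _ _) _; apply: lerD; last first.
  apply: le_trans (ler_ell2_normD _ _) _; apply: lerD; apply: small => j jr.
    apply: le_trans (ell2_norm_avg_compl _ q0 (aD j jr)) _.
    by rewrite ler_wpM2l ?invr_ge0 ?ler0n// py ell2_norm_cutoff.
  apply: le_trans (ell2_norm_avg_off (D := D j) q0 (aD j jr) _) _.
    by move=> g Dg; rewrite cutoffE /= Dg.
  rewrite ler_wpM2l ?invr_ge0 ?ler0n//.
  by apply: le_trans (ell2_norm_cutoff _ _) _; rewrite ell2_norm_lreg.
rewrite -ler_sqr ?nnegrE ?mulr_ge0 ?ell2_norm_ge0//.
rewrite (ell2_normsq_sum ur dD); last first.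
  move=> j g _ /negPf Dg.
  rewrite [LHS](_ : _ = (c j)%:C%C * cutoff (D j) (avg q (u j) (p j)) g)//.
  by rewrite cutoffE Dg mulr0.
rewrite exprMn.
apply: (@le_trans _ _ (C ^+ 2 *
    \sum_(j <- r) ell2_norm (cutoff (fun g => D j (t j * g)%g) x) ^+ 2)).
  rewrite mulr_sumr big_seq [leRHS]big_seq; apply: ler_sum => j jr.
  rewrite ell2_normZ -exprMn.
  rewrite ler_sqr ?nnegrE ?mulr_ge0 ?normc_ge0 ?ell2_norm_ge0//.
  apply: ler_pM; rewrite ?normc_ge0 ?ell2_norm_ge0 ?normc_c// -py.
  exact: le_trans (ell2_norm_cutoff _ _) (ell2_norm_avg _ _ q0).
rewrite ler_wpM2l ?sqr_ge0//.
exact: (sum_ell2_normsq_cutoff (D := fun j g => D j (t j * g)%g)).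
Qed.

End AveragedTranslations.

(** * Blocks in reduced words *)

Section Words.
Variable n : nat.
Local Notation letter := ('I_n * bool)%type.
Local Notation F := (freeGroup n).
Implicit Types (s t : letter) (p q r : seq letter) (g h d : F).

Definition len g := size (word g).

Lemma word_mul g h : word (g * h)%g = foldr (@push n) (word h) (word g).
Proof. by []. Qed.

Lemma len1 : len 1%g = 0%N. Proof. by []. Qed.

Lemma lenV g : len g^-1%g = len g.
Proof. by rewrite /len /= size_rev size_map. Qed.

Lemma lenM g h : (len (g * h)%g <= len g + len h)%N.
Proof.
rewrite /len word_mul; elim: (word g) => //= s p; rewrite addSn.
by case: (foldr _ _ _) => [|t q] //=; case: eqP => _ /=; lia.
Qed.

Lemma invl_neq s : (invl s == s) = false.
Proof. by case: s => i []; rewrite /invl xpair_eqE eqxx. Qed.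

Lemma foldr_push_cat p q : reduced (p ++ q) -> foldr (@push n) q p = p ++ q.
Proof.
elim: p => //= s p IHp spq; rewrite IHp ?(reduced_behead spq)//.
by case: (p ++ q) spq => //= t r /andP[/negPf ->].
Qed.

Lemma foldr_push_rev p q : foldr (@push n) (rev (map (@invl n) p) ++ q) p = q.
Proof.
elim/last_ind: p q => //= p s IHp q.
by rewrite map_rcons rev_rcons foldr_rcons /= eqxx IHp.
Qed.

(** Cancellation that stops before the end of [s :: p] leaves its first letter
    in place; a full cancellation needs its inverse as a prefix of [q]. *)
Lemma foldr_push_head s p q : reduced (s :: p) ->
  prefix (rev (map (@invl n) (s :: p))) q \/
  exists r, foldr (@push n) q (s :: p) = s :: r.
Proof.
elim: p s => [|t p IHp] s.
  case: q => [|t q] _; first by right; exists [::].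
  rewrite [foldr _ _ _]/=.
  by case: eqP => [->|_]; [left; apply/prefixP; exists q|right; exists (t :: q)].
move=> spr; have [/prefixP[r ->]|[r qr]] := IHp t (reduced_behead spr).
  have -> : foldr (@push n) (rev (map (@invl n) (t :: p)) ++ r) (s :: t :: p) =
      push s r by rewrite -[in RHS](foldr_push_rev (t :: p) r).
  case: r => [|x r] /=; first by right; exists [::].
  case: eqP => [->|_]; last by right; exists (x :: r).
  left; rewrite [map _ _]/= !rev_cons -!cats1 -!catA; apply/prefixP.
  by exists r; rewrite -!catA.
right; exists (t :: r); rewrite -[LHS]/(push s (foldr (@push n) q (t :: p))) qr /=.
by move: spr => /= /andP[/negPf -> _].
Qed.

(** A short left factor replaces a short prefix and leaves the rest of the word
    alone, up to a shift. *)
Lemma foldr_push_shift p q : exists r i,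
  [/\ foldr (@push n) q p = r ++ drop i q, size r <= size p & i <= size p]%N.
Proof.
elim: p => [|s p IHp] /=; first by exists [::], 0%N; rewrite drop0.
have [r [i [-> rp ip]]] := IHp.
case: r rp => [|t r] /= rp; last first.
  case: eqP => _; first by exists r, i; split=> //; lia.
  by exists [:: s, t & r], i; split=> //; exact: leqW.
case dq: (drop i q) => [|t q'] /=.
  by exists [:: s], i; split=> //; [rewrite dq|exact: leqW].
case: eqP => _; last by exists [:: s], i; split=> //; [rewrite dq|exact: leqW].
by exists [::], i.+1; split=> //; rewrite -add1n -drop_drop dq /= drop0.
Qed.

Definition block m s t := nseq m s ++ nseq m t.

Definition starts m s t g := prefix (block m s t) (word g).

Lemma starts_nth m s t g x0 i : starts m s t g -> (i < m + m)%N ->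
  nth x0 (word g) i = if (i < m)%N then s else t.
Proof.
move=> /prefixP[r ->] im; rewrite nth_cat size_cat !size_nseq im.
rewrite nth_cat size_nseq !nth_nseq; case: ltnP => // mi.
by rewrite ltn_subLR// im.
Qed.

(** The two places where the letter changes in the blocks must coincide, so a
    short translation between them does not move the rest of the word. *)
Lemma starts_shift m s t s' t' g d : s' != t' -> (len g < m)%N ->
  starts m s t d -> starts m s' t' (g * d)%g -> [/\ g = 1%g, s = s' & t = t'].
Proof.
move=> st' gm sd sgd.
have [r [i [wgd rg ig]]] := foldr_push_shift (word g) (word d).
have rm := leq_ltn_trans rg gm; have im := leq_ltn_trans ig gm.
have wE j : (size r <= j < m + m)%N -> (i + (j - size r) < m + m)%N ->
    (if (j < m)%N then s' else t') = if (i + (j - size r) < m)%N then s else t.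
  move=> /andP[rj jm] jm'; rewrite -(starts_nth s sgd jm) -(starts_nth s sd jm').
  by rewrite word_mul wgd nth_cat ltnNge rj /= nth_drop.
have e1 : s' = if (i + (m.-1 - size r) < m)%N then s else t.
  by rewrite -wE; [rewrite ifT//; lia|lia|lia].
have e2 : t' = if (i + (m - size r) < m)%N then s else t.
  by rewrite -wE; [rewrite ltnn|lia|lia].
(* The letters at the places m - 1 and m of the product differ, so they must
   come from the places m - 1 and m of [d]; hence the shift is zero. *)
case: ltnP e2 => h2 e2.
  by move: e1; rewrite ifT -?e2 => [e1|]; [rewrite e1 eqxx in st'|lia].
case: ltnP e1 => h1 e1; last by rewrite e1 e2 eqxx in st'.
have ir : i = size r by lia.
split=> //; apply: (mulIg d); rewrite mul1g; apply: val_inj.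
rewrite [LHS]wgd -[RHS](cat_take_drop i (word d)); congr (_ ++ _).
have -> : r = take i (word (g * d)%g) by rewrite word_mul wgd ir take_size_cat.
move: sd sgd => /prefixP[q ->] /prefixP[q' ->].
by rewrite e1 e2 /block -!catA !takel_cat ?size_nseq ?(ltnW im).
Qed.

Lemma path_nseq m s : path (fun s t => t != invl s) s (nseq m s).
Proof. by elim: m => //= m ->; rewrite eq_sym invl_neq. Qed.

Lemma last_nseq m s : last s (nseq m s) = s.
Proof. by elim: m. Qed.

Lemma block_reduced m s t : t != invl s -> reduced (block m s t).
Proof.
move=> ts; rewrite /reduced /block; case: m => //= m.
by rewrite cat_path path_nseq last_nseq /= ts path_nseq.
Qed.

Definition blockg m s t (st : t != invl s) : F := FreeGroup (block_reduced m st).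

Lemma starts_word m s t g : (0 < m)%N -> starts m s t g ->
  exists r, word g = s :: r.
Proof.
case: m => // m _ /prefixP[r ->]; rewrite /block /= -catA.
by eexists.
Qed.

(** No cancellation occurs in such a product. *)
Lemma starts_mul_blockg m s t (st : t != invl s) g x r :
  (0 < m)%N -> word g = x :: r -> x != invl t -> starts m s t (blockg m st * g)%g.
Proof.
move=> m0 wg xt; rewrite /starts word_mul foldr_push_cat ?prefix_prefix//.
have := block_reduced m st; have := valP g; rewrite [\val g]wg.
case: m m0 => // k _ xr br.
rewrite /reduced /block -[sorted _ _]/(path _ s _) cat_path.
apply/andP; split; first exact: br.
rewrite last_cat -[nseq k.+1 t]/(t :: _) last_cons last_nseq wg.
by change ((x != invl t) && reduced (x :: r)); rewrite xt.
Qed.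

Section Cylinder.
Variables (a b : letter) (m : nat).
Hypotheses (ab : b != a) (ab' : b != invl a) (m0 : (0 < m)%N).

Lemma invl_swap : a != invl b.
Proof. by rewrite eq_sym (inv_eq (@invlK n)). Qed.

(** The words that begin with a^m b^m or with its inverse. *)
Definition cylinder g := starts m a b g || starts m (invl b) (invl a) g.

(** The square of a^m b^m: when one factor is partly cancelled by [g], the
    other one survives as a prefix. *)
Definition pusher : F := (blockg m ab' * blockg m ab')%g.

(** The element b^m a^m. *)
Definition shifter : F := blockg m invl_swap.

Lemma starts_pusher g : ~~ starts m (invl b) (invl a) g ->
  starts m a b (pusher * g)%g.
Proof.
move=> ng; rewrite /pusher -mulgA.
have [r wr] : exists r, word (blockg m ab' * g)%g = a :: r.
  have := block_reduced m ab'; rewrite word_mul -[word (blockg m ab')]/(block m a b).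
  rewrite /starts in ng; move: ng.
  have <- : rev (map (@invl n) (block m a b)) = block m (invl b) (invl a).
    by rewrite map_cat rev_cat !map_nseq !rev_nseq.
  case: m m0 => // k _ ng br.
  by have [pg|] := foldr_push_head (word g) br; first by rewrite pg in ng.
by apply: starts_mul_blockg wr _ => //; exact: invl_swap.
Qed.

Lemma starts_disjoint g : starts m a b g -> ~~ starts m (invl b) (invl a) g.
Proof.
move=> /(starts_word m0)[r wg]; apply/negP => /(starts_word m0)[r' wg'].
by have := invl_swap; rewrite wg in wg'; case: wg' => ->; rewrite eqxx.
Qed.

Lemma absorbs_cylinder : absorbs pusher cylinder.
Proof.
move=> j g j0; rewrite negb_or => /andP[_ ng]; apply/orP; left.
elim: j j0 => // -[|j] IHj _; first by rewrite expg1 starts_pusher.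
by rewrite expgS -mulgA starts_pusher// starts_disjoint// IHj.
Qed.

Lemma cylinder1 : ~~ cylinder 1%g.
Proof.
by apply/norP; split; apply/negP => /(starts_word m0)[].
Qed.

Lemma invl_inj : injective (@invl n). Proof. exact: can_inj (@invlK n). Qed.

Lemma cylinder_shift g d : (len g < m)%N -> cylinder d -> cylinder (g * d)%g ->
  g = 1%g.
Proof.
have ab1 : a != b by rewrite eq_sym.
have ab2 : invl b != invl a by rewrite (inj_eq invl_inj).
move=> gm /orP[] sd /orP[] sgd.
- by have [] := starts_shift ab1 gm sd sgd.
- by have [_ e _] := starts_shift ab2 gm sd sgd; have := invl_swap; rewrite -e eqxx.
- by have [_ e _] := starts_shift ab1 gm sd sgd; have := invl_swap; rewrite e eqxx.
- by have [] := starts_shift ab2 gm sd sgd.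
Qed.

Lemma starts_shifter d : cylinder d -> starts m b a (shifter * d)%g.
Proof.
case/orP => /(starts_word m0)[r wd]; apply: starts_mul_blockg wd _ => //.
  by rewrite eq_sym invl_neq.
by rewrite (inj_eq invl_inj).
Qed.

Lemma shifter_cylinder g d : (len g < m)%N -> cylinder d ->
  ~~ cylinder (g * (shifter * d))%g.
Proof.
move=> gm /starts_shifter sd; apply/negP => /orP[] sgd.
  have ab1 : a != b by rewrite eq_sym.
  by have [_ e _] := starts_shift ab1 gm sd sgd; have := ab; rewrite e eqxx.
have ab2 : invl b != invl a by rewrite (inj_eq invl_inj).
by have [_ e _] := starts_shift ab2 gm sd sgd; have := invl_neq b; rewrite -e eqxx.
Qed.

Lemma shifter_shift g d d' : (len g < m)%N -> cylinder d -> cylinder d' ->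
  (g * (shifter * d) = shifter * d')%g -> g = 1%g.
Proof.
move=> gm /starts_shifter sd /starts_shifter sd' e; rewrite -e in sd'.
by have [] := starts_shift ab gm sd sd'.
Qed.

End Cylinder.
End Words.

(** * Slowly varying functions on the free group *)

Section Ball.
Variable n : nat.
Local Notation F := (freeGroup n).

Definition ball_seq k : seq F :=
  pmap insub [seq bseqval w | w <- enum {: k.-bseq ('I_n * bool)}].

Lemma mem_ball_seq k x : (x \in ball_seq k) = (len x <= k)%N.
Proof.
rewrite mem_pmap_sub; apply/mapP/idP => [[w _ e]|xk].
  by rewrite /len -[word x]/(\val x) e size_bseq.
by exists (Bseq xk) => //; rewrite mem_enum.
Qed.

Lemma ball_seq_uniq k : uniq (ball_seq k).
Proof.
by apply: pmap_sub_uniq; rewrite map_inj_uniq ?enum_uniq//; exact: val_inj.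
Qed.

End Ball.

Section Tent.
Variables (R : realType) (n k : nat).
Local Notation F := (freeGroup n).
Implicit Types g x : F.

Definition tent x : R := Num.max 0 (1 - (len x)%:R / k.+1%:R).

Lemma tent_ge0 x : 0 <= tent x.
Proof. by rewrite /tent le_max lexx. Qed.

Lemma tent_le1 x : tent x <= 1.
Proof. by rewrite /tent ge_max ler01/= gerBl divr_ge0. Qed.

Lemma tent1 : tent 1%g = 1.
Proof. by rewrite /tent len1 mul0r subr0 max_r. Qed.

Lemma tent_eq0 x : (k < len x)%N -> tent x = 0.
Proof.
move=> kx; rewrite /tent max_l// subr_le0 ler_pdivlMr ?ltr0n//.
by rewrite mul1r ler_nat.
Qed.

Lemma len_mulVg g x : (len x <= len g + len (g^-1 * x)%g)%N.
Proof. by rewrite -{1}(mulVKg g x) lenM. Qed.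

Lemma tent_lipschitz g x :
  `|tent (g^-1 * x)%g - tent x| <= (len g)%:R / k.+1%:R.
Proof.
have k0 : 0 < k.+1%:R^-1 :> R by rewrite invr_gt0 ltr0n.
have h1 : (len x)%:R <= (len g)%:R + (len (g^-1 * x)%g)%:R :> R.
  by rewrite -natrD ler_nat len_mulVg.
have h2 : (len (g^-1 * x)%g)%:R <= (len g)%:R + (len x)%:R :> R.
  by rewrite -natrD ler_nat -(lenV g) lenM.
rewrite /tent; set p := (len x)%:R in h1 h2 *.
set q := (len (_ * _)%g)%:R in h1 h2 *; set r := (len g)%:R in h1 h2 *.
set c := _^-1 in k0 *.
have h1' : p * c <= r * c + q * c by rewrite -mulrDl ler_pM2r.
have h2' : q * c <= r * c + p * c by rewrite -mulrDl ler_pM2r.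
have r0 : 0 <= r * c by rewrite mulr_ge0 ?ler0n// ltW.
rewrite ler_norml; apply/andP.
by case: (leP 0 (1 - q * c)) => ?; case: (leP 0 (1 - p * c)) => ?; split; lra.
Qed.

End Tent.

(** * Point masses and nonnegative vectors *)

Section Delta.
Variables (R : realType) (I : choiceType).

Lemma sqsum_delta (j : I) : sqsum (fun i => (i == j)%:R : R[i]) = 1%E.
Proof.
rewrite -[RHS](esum_set1 (t := j) (a := fun=> 1%E)) ?lee01// /sqsum.
rewrite [RHS]esum_mkcond; apply: eq_esum => i _.
case: eqVneq => [->|ij]; first by rewrite mem_set// normc1 expr1n.
by rewrite memNset ?normc0 ?expr0n//; exact/eqP.
Qed.

Lemma delta_subproof (j : I) : (fun i => (i == j)%:R) \in @ell2_pred R I.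
Proof. by rewrite unfold_in /ell2_pred sqsum_delta ltry. Qed.

Definition delta (j : I) : ell2 R I := Ell2 (delta_subproof j).

Lemma ell2_norm_delta j : ell2_norm (delta j) = 1.
Proof. by rewrite /ell2_norm sqsum_delta sqrtr1. Qed.

End Delta.

Section Positivity.
Variables (R : realType) (G : groupType).
Local Notation H := (ell2 R G).

Definition nonneg (y : H) := forall g, 0 <= y g.

Lemma avg_at q u (y : H) g : avg R q u y g =
  ((q%:R ^+ 2)^-1 : R)%:C%C * \sum_(j <- iota 1 (q ^ 2)) y ((u ^+ j)^-1 * g)%g.
Proof.
rewrite avgE [LHS](_ : _ = ((q%:R ^+ 2)^-1 : R)%:C%C *
  (\sum_(j <- iota 1 (q ^ 2)) lreg R (u ^+ j)%g y : H) g)//.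
by rewrite ell2_sumE.
Qed.

Lemma nonneg_avg q u y : nonneg y -> nonneg (avg R q u y).
Proof.
move=> y0 g; rewrite avg_at mulr_ge0 ?sumr_ge0//.
by rewrite lecR invr_ge0 exprn_ge0.
Qed.

Lemma avg_ge1 q u (y : H) (l M : nat) : (0 < q)%N -> 
  (forall i, (l < i <= M)%N -> 1 <= y (u ^+ i)%g) ->
  forall i, (l + q ^ 2 < i <= M)%N -> 1 <= avg R q u y (u ^+ i)%g.
Proof.
move=> q0 y1 i /andP[li iM]; have q0' : 0 < q%:R :> R by rewrite ltr0n.
rewrite avg_at.
have -> : 1 = ((q%:R ^+ 2)^-1 : R)%:C%C * (q ^ 2)%:R.
  by rewrite -[(q ^ 2)%:R](rmorph_nat (@real_complex R)) -rmorphM natrX mulVf// expf_neq0// gt_eqF.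
apply: ler_wpM2l; first by rewrite lecR invr_ge0 exprn_ge0.
rewrite -[X in X%:R](size_iota 1 (q ^ 2)) -sum1_size natr_sum.
rewrite big_seq [leRHS]big_seq; apply: ler_sum => j.
rewrite mem_iota add1n ltnS => /andP[j1 jq].
have ji : (j <= i)%N by lia.
by rewrite -{1}(subnKC ji) expgnDr mulKg; apply: y1; lia.
Qed.

End Positivity.

(** * Asymptotically central operators *)

Section CentralOperators.
Variables (R : realType) (n : nat) (a b : 'I_n * bool).
Hypotheses (ab : b != a) (ab' : b != invl a).
Variable k : nat.
Local Notation F := (freeGroup n).
Local Notation H := (ell2 R F).

(* A tent of radius [k] translated by an element of length at most [k] is
   supported in [X], and quotients of elements of [X] are shorter than [m]. *)
Let X : seq F := ball_seq n (2 * k).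
Let m := (4 * k).+1.
(* Makes the error term in the norm bound equal to 1/8. *)
Let q := (16 * size X)%N.
Let m0 : (0 < m)%N. Proof. by []. Qed.
Let u : F := pusher m ab'.
Let v : F := ((shifter m ab')^-1)%g.
Let D : pred F := cylinder a b m.

Let X1 : 1%g \in X. Proof. by rewrite mem_ball_seq. Qed.

Let q_gt0 : (0 < q)%N.
Proof. by rewrite muln_gt0/=; case: X X1. Qed.

Let q_gt0R : 0 < q%:R :> R. Proof. by rewrite ltr0n. Qed.

Let X_div_q : (size X)%:R / q%:R = 16^-1 :> R.
Proof.
have X0 : (size X)%:R != 0 :> R by rewrite pnatr_eq0 -lt0n; case: X X1.
by rewrite /q natrM; field.
Qed.

Let len_small x y : x \in X -> y \in X -> (len (x^-1 * y)%g < m)%N.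
Proof.
rewrite !mem_ball_seq => xk yk; rewrite ltnS.
by apply: leq_trans (lenM _ _) _; rewrite lenV; lia.
Qed.

Let absorbs_conj x : absorbs (x * u * x^-1)%g (fun g => D (x^-1 * g)%g).
Proof.
move=> j g j0 Dg; rewrite expgn_conj.
by rewrite -!mulgA mulKg; apply: absorbs_cylinder.
Qed.

Let disjoint_D : disjoint_family X (fun x g => D (x^-1 * g)%g).
Proof.
move=> x y g xX yX Dx Dy; apply/eqP; rewrite -(inj_eq (mulgI x^-1)%g) mulVg.
rewrite eq_sym; apply/eqP; apply: (cylinder_shift ab ab' (len_small xX yX)) => //.
  exact: Dy.
by rewrite -mulgA mulVKg.
Qed.

Let disjoint_vD : disjoint_family X (fun x g => D (v * (x^-1 * g))%g).
Proof.
move=> x y g xX yX Dx Dy; apply/eqP; rewrite -(inj_eq (mulgI x^-1)%g) mulVg.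
rewrite eq_sym; apply/eqP.
apply: (shifter_shift ab m0 (len_small xX yX) Dy Dx).
by rewrite !mulVKg -mulgA mulVKg.
Qed.

Definition summand (t x : F) : bop H :=
  lreg R x * (avg R q u * lreg R t) * lreg R x^-1%g.

Lemma summandE t x : summand t x =
  avg R q (x * u * x^-1)%g * lreg R (x * t * x^-1)%g.
Proof.
rewrite /summand -avg_conj !Defs.lregM !mulrA.
rewrite -[lreg R x * _ * lreg R x^-1%g * lreg R x]mulrA.
by rewrite lregVK mulr1.
Qed.

(** The norm bound applies because the sets x t^-1 D, with x in X, are disjoint
    for both values of t. *)
Lemma summand_sum_le t (c : F -> R) C : t = 1%g \/ t = v -> 0 <= C ->
  (forall x, x \in X -> `|c x| <= C) ->
  opnorm (\sum_(x <- X) (c x)%:C%C *: summand t x) <= 2 * C.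
Proof.
move=> tv C0 cC; under eq_bigr do rewrite summandE.
apply: le_trans (opnorm_sum_avg_le (D := fun x g => D (x^-1 * g)%g)
  (C := C) q_gt0 C0 _ cC _ disjoint_D _) _.
- exact: ball_seq_uniq.
- by move=> x _; exact: absorbs_conj.
- case: tv => -> x y g xX yX.
    by rewrite !mulg1 !mulgV !mul1g; exact: disjoint_D.
  by rewrite -!mulgA !mulKg; exact: disjoint_vD.
rewrite -mulrA X_div_q; lra.
Qed.

Definition central_op t : bop H :=
  \sum_(x <- X) (tent R k x)%:C%C *: summand t x.

Lemma central_op_span t : group_span (central_op t).
Proof.
apply: group_span_sum => x; apply: group_spanZ; rewrite summandE.
apply: group_spanM; last exact: group_span_lreg.
by apply: group_spanZ; apply: group_span_sum => j; exact: group_span_lreg.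
Qed.

Lemma opnorm_central_op_le t : t = 1%g \/ t = v -> opnorm (central_op t) <= 2.
Proof.
move=> tv; rewrite -[leRHS]mulr1; apply: summand_sum_le => // x _.
by rewrite ger0_norm ?tent_ge0 ?tent_le1.
Qed.

(** Conjugating by [g] replaces the tent by its translate, still supported in
    [X], so that the commutator is again a combination of the summands, with
    small coefficients. *)
Lemma central_op_commutator t g : t = 1%g \/ t = v -> (len g <= k)%N ->
  opnorm (central_op t * lreg R g - lreg R g * central_op t) <=
    2 * ((len g)%:R / k.+1%:R).
Proof.
move=> tv gk.
have -> : lreg R g * central_op t =
    (\sum_(y <- X) (tent R k (g^-1 * y)%g)%:C%C *: summand t y) * lreg R g.
  rewrite /central_op mulr_sumr mulr_suml.
  have trans x : lreg R g * summand t x = summand t (g * x)%g * lreg R g.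
    by rewrite /summand invgM !Defs.lregM -!mulrA lregVK mulr1.
  transitivity (\sum_(x <- [seq x <- X | (len x <= k)%N])
      (tent R k (g^-1 * (g * x))%g)%:C%C *: (summand t (g * x)%g * lreg R g)).
    rewrite big_filter [LHS](bigID (fun x : F => len x <= k)%N)/=.
    rewrite [X in _ + X]big1 ?addr0 => [|x]; last first.
      by rewrite -ltnNge => kx; rewrite tent_eq0// scale0r mulr0.
    by apply: eq_bigr => x _; rewrite -bop_scalerAr trans mulKg.
  rewrite -(big_map (fun x => g * x)%g predT (fun y =>
      (tent R k (g^-1 * y)%g)%:C%C *: (summand t y * lreg R g))).
  rewrite [RHS](bigID (fun y : F => len (g^-1 * y)%g <= k)%N)/=.
  rewrite [X in _ = _ + X]big1 ?addr0 => [|x]; last first.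
    by rewrite -ltnNge => kx; rewrite tent_eq0// scale0r mul0r.
  rewrite -[RHS]big_filter.
  under [RHS]eq_bigr do rewrite -bop_scalerAl.
  apply: perm_big; apply: uniq_perm.
  - by rewrite map_inj_uniq ?filter_uniq ?ball_seq_uniq//; exact: mulgI.
  - by rewrite filter_uniq// ball_seq_uniq.
  - move=> y; rewrite mem_filter mem_ball_seq; apply/mapP/andP.
      move=> [x]; rewrite mem_filter => /andP[xk _] ->; rewrite mulKg xk.
      by split=> //; apply: leq_trans (lenM _ _) _; lia.
    move=> [yk _]; exists (g^-1 * y)%g; last by rewrite mulVKg.
    by rewrite mem_filter yk mem_ball_seq (leq_trans yk)//; lia.
rewrite -mulrBl; apply: le_trans (opnormM _ _) _.
apply: le_trans (ler_wpM2l (opnorm_ge0 _) (opnorm_lreg_le R g)) _.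
rewrite mulr1 /central_op -sumrB.
have -> : \sum_(x <- X) ((tent R k x)%:C%C *: summand t x -
      (tent R k (g^-1 * x)%g)%:C%C *: summand t x) =
    \sum_(x <- X) (tent R k x - tent R k (g^-1 * x)%g)%:C%C *: summand t x.
  by apply: eq_bigr => x _; rewrite -scalerBl -rmorphB.
apply: summand_sum_le => // x _.
by rewrite distrC tent_lipschitz.
Qed.

Lemma summand_at t x (y : H) g : summand t x y g =
  avg R q u (lreg R t (lreg R x^-1%g y)) (x^-1 * g)%g.
Proof. by []. Qed.

Lemma central_op_at t (y : H) g : central_op t y g =
  \sum_(x <- X) (tent R k x)%:C%C * summand t x y g.
Proof.
rewrite /central_op bop_sumE ell2_sumE; apply: eq_bigr => x _.
exact: bop_scale_at.
Qed.

Lemma nonneg_summand t x y : nonneg y -> nonneg (summand t x y).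
Proof. by move=> y0 g; rewrite summand_at; apply: nonneg_avg => h; rewrite !lregE. Qed.

Lemma nonneg_central_op t y : nonneg y -> nonneg (central_op t y).
Proof.
move=> y0 g; rewrite central_op_at sumr_ge0// => x _.
by rewrite mulr_ge0 ?nonneg_summand// lecR tent_ge0.
Qed.

Lemma central_op_ge t y g : nonneg y ->
  avg R q u (lreg R t y) g <= central_op t y g.
Proof.
move=> y0; rewrite central_op_at (bigD1_seq 1%g) ?ball_seq_uniq//.
rewrite tent1 mul1r summand_at invg1 Defs.lreg1 mul1g lerDl sumr_ge0// => x _.
by rewrite mulr_ge0 ?nonneg_summand// lecR tent_ge0.
Qed.

Let u_pow_cylinder j : (0 < j)%N -> D (u ^+ j)%g.
Proof.
move=> j0; rewrite -[(u ^+ j)%g]mulg1.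
by apply: absorbs_cylinder => //; exact: cylinder1.
Qed.

Let u_pow_inj : injective (fun j => u ^+ j)%g.
Proof.
move=> i j; wlog ij : i j / (i < j)%N => [ih e|].
  have [ij|ji|//] := ltngtP i j; first exact: ih.
  by apply/esym/ih.
rewrite -(subnKC (ltnW ij)) expgnDr -[LHS]mulg1 => /mulgI e.
have := @u_pow_cylinder (j - i); rewrite subn_gt0 -e => /(_ ij).
by move=> /(negP (cylinder1 a b m0)).
Qed.

(* The orbit is four times as long as its initial part of length 2 q^2, on
   which two successive averages lose mass. *)
Let xi : H := \sum_(i <- iota 1 (8 * q ^ 2)) delta R (v^-1 * u ^+ i)%g.

Let norm_xi : ell2_norm xi ^+ 2 = 8 * q%:R ^+ 2.
Proof.
rewrite (@ell2_normsq_sum _ _ _ _ (fun i g => g == v^-1 * u ^+ i)%g).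
- under eq_bigr do rewrite ell2_norm_delta expr1n.
  by rewrite big_const_seq count_predT size_iota iter_addr_0 natrM natrX.
- exact: iota_uniq.
- by move=> i j g _ _ /eqP -> /eqP/mulgI/u_pow_inj.
- by move=> i g _ /negPf gi; rewrite [LHS](_ : _ = (g == v^-1 * u ^+ i)%g%:R)// gi.
Qed.

Let nonneg_xi : nonneg xi.
Proof. by move=> g; rewrite ell2_sumE sumr_ge0// => i _; exact: ler0n. Qed.

Let xi_ge1 i : (0 < i <= 8 * q ^ 2)%N -> 1 <= lreg R v xi (u ^+ i)%g.
Proof.
move=> i8; rewrite lregE ell2_sumE (bigD1_seq i) ?iota_uniq//=; last first.
  by rewrite mem_iota; lia.
rewrite [X in _ <= X + _](_ : _ = 1).
  by rewrite lerDl sumr_ge0// => j _; exact: ler0n.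
by rewrite /delta /= eqxx.
Qed.

(* A short left factor cannot turn v^-1 u ^+ i, which begins with b^m a^m, into
   an element of [D]. *)
Let xi_off x g : x \in X -> D (x^-1 * g)%g -> xi g = 0.
Proof.
move=> xX Dg; rewrite ell2_sumE big_seq big1// => i.
rewrite mem_iota => /andP[i1 _].
rewrite [LHS](_ : _ = (g == v^-1 * u ^+ i)%g%:R)//.
case: eqP => // gE; have xm := len_small xX X1; rewrite mulg1 in xm.
case/negP: (shifter_cylinder ab ab' m0 xm (u_pow_cylinder i1)).
by move: Dg; rewrite gE /v invgK.
Qed.

Let norm_lower : 6 * q%:R ^+ 2 <= ell2_norm (central_op 1%g (central_op v xi)) ^+ 2.
Proof.
set z := central_op 1%g _.
have z1 i : (q ^ 2 + q ^ 2 < i <= 8 * q ^ 2)%N -> 1 <= z (u ^+ i)%g.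
  move=> iq; apply: le_trans (central_op_ge _ _ _); last first.
    exact: nonneg_central_op.
  rewrite Defs.lreg1; apply: (avg_ge1 (l := q ^ 2) (M := 8 * q ^ 2)) iq => // j jq.
  apply: le_trans (central_op_ge _ _ _) => //.
  by apply: (avg_ge1 (l := 0) (M := 8 * q ^ 2)) jq => // j'; exact: xi_ge1.
pose s := [seq (u ^+ i)%g | i <- iota (q ^ 2 + q ^ 2).+1 (6 * q ^ 2)].
have us : uniq s by rewrite map_inj_uniq ?iota_uniq.
apply: le_trans (ell2_normsq_ge z us).
have -> : 6 * q%:R ^+ 2 = (size s)%:R :> R.
  by rewrite size_map size_iota natrM natrX.
rewrite -sum1_size natr_sum big_seq [leRHS]big_seq.
apply: ler_sum => _ /mapP[i iq ->].
have zi : 1 <= z (u ^+ i)%g by apply: z1; move: iq; rewrite mem_iota; lia.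
rewrite -[leLHS](expr1n _ 2) ler_sqr ?nnegrE ?normc_ge0//.
rewrite -lecR; apply: le_trans (zi) _.
by rewrite -[leLHS](ger0_norm (le_trans ler01 zi)).
Qed.

Let norm_upper : ell2_norm (central_op 1%g xi) <= 16^-1 * ell2_norm xi.
Proof.
have -> : central_op 1%g xi =
    \sum_(x <- X) (tent R k x)%:C%C *: avg R q (x * u * x^-1)%g xi.
  rewrite /central_op bop_sumE; apply: eq_bigr => x _.
  by rewrite summandE mulg1 mulgV Defs.lreg1 mulr1.
apply: (@le_trans _ _ (\sum_(x <- X) q%:R^-1 * ell2_norm xi)).
  apply: ell2_norm_sum_le => x xX.
  rewrite ell2_normZ normc_real_ge0 ?tent_ge0//.
  rewrite -[leRHS]mul1r; apply: ler_pM; rewrite ?tent_ge0 ?ell2_norm_ge0 ?tent_le1//.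
  apply: (ell2_norm_avg_off q_gt0 (@absorbs_conj x)) => g; exact: xi_off.
rewrite big_const_seq count_predT iter_addr_0 -[_ *+ size X]mulr_natl mulrA.
by rewrite X_div_q.
Qed.

(** With S, T the two operators, S T xi has norm at least sqrt (3/4) that of
    xi, while T S xi has norm at most 2/16 that of xi. *)
Lemma central_op_noncommuting : 2^-1 <=
  opnorm (central_op 1%g * central_op v - central_op v * central_op 1%g).
Proof.
set S := central_op 1%g; set T := central_op v; set be := opnorm _.
have xi0 := ell2_norm_ge0 xi.
have be0 : 0 <= be := opnorm_ge0 _.
have h1 : ell2_norm (S (T xi)) <= (be + 8^-1) * ell2_norm xi.
  rewrite (_ : S (T xi) = (S * T - T * S) xi + T (S xi)); last first.
    by rewrite -[RHS]/(S (T xi) - T (S xi) + T (S xi)) subrK.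
  apply: le_trans (ler_ell2_normD _ _) _; rewrite mulrDl; apply: lerD.
    exact: ell2_norm_opnorm.
  apply: le_trans (ell2_norm_opnorm _ _) _.
  have -> : 8^-1 * ell2_norm xi = 2 * (16^-1 * ell2_norm xi) by field.
  apply: ler_pM; rewrite ?opnorm_ge0 ?ell2_norm_ge0 ?norm_upper//.
  by apply: opnorm_central_op_le; right.
have h2 : ell2_norm (S (T xi)) ^+ 2 <= (be + 8^-1) ^+ 2 * (8 * q%:R ^+ 2).
  rewrite -norm_xi -exprMn ler_sqr ?nnegrE ?ell2_norm_ge0//.
  by rewrite mulr_ge0// addr_ge0// invr_ge0.
have := le_trans norm_lower h2; rewrite mulrA ler_pM2r ?exprn_gt0//.
move=> h3; rewrite leNgt; apply/negP => bel.
nra.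
Qed.

End CentralOperators.

(** * The ultrapower *)

Lemma freeUltrafilter_tail (w : freeUltrafilter nat) : (ultraset w `=>` \oo)%classic.
Proof.
have uw := ultrasetP w; have fw := @ultra_proper _ _ uw.
have wN j : ultraset w (~` [set j])%classic.
  have [wj|//] := in_ultra_setVsetC [set j]%classic uw.
  have : (\bigcap_(A in ultraset w) A)%classic j.
    move=> A wA; by have [x [Ax <-]] := filter_ex (filterI wA wj).
  by rewrite ultraset_free.
move=> A [N _ NA]; suff wNN : forall K, ultraset w [set i | (K <= i)%N]%classic.
  exact: filterS NA (wNN N).
elim=> [|K IHK]; first by apply: filterS filterT.
apply: filterS (filterI IHK (wN K)) => i [/= Ki iK].
by rewrite ltn_neqAle Ki andbT; apply/eqP => Ki'; apply: iK.
Qed.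

Section CentralSequence.
Variables (R : realType) (n : nat) (a b : 'I_n * bool).
Hypotheses (ab : b != a) (ab' : b != invl a).
Local Notation F := (freeGroup n).
Local Notation A := (reduced_cstar R F).
Local Notation N := (cred_norm R F).

Section Sequence.
(* Treats the factors 1 and v at once. *)
Variable t : nat -> F.
Hypothesis tE : forall k, t k = 1%g \/ t k = ((shifter (4 * k).+1 ab')^-1)%g.

Let op k := central_op R ab' k (t k).

Definition central_term k : A := ReducedCstar (sub_cred (central_op_span R ab' k (t k))).

Lemma central_term_bounded : central_term \in ellinf_pred N.
Proof.
by apply/asboolP; exists 2 => k; exact: (opnorm_central_op_le R ab (tE k)).
Qed.

Lemma lreg_commutator_cvg g :
  (opnorm (op k * lreg R g - lreg R g * op k) @[k --> \oo] --> (0 : R))%classic.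
Proof.
apply: (@squeeze_cvgr _ _ _ _ (fun=> 0) (fun k => 2 * (len g)%:R * harmonic k)).
- near=> k; rewrite opnorm_ge0/=.
  apply: le_trans (central_op_commutator R ab (tE k) _) _; last by rewrite mulrA.
  by near: k; exact: nbhs_infty_ge.
- exact: cvg_cst.
- by rewrite -[X in (_ --> X)%classic](mulr0 (2 * (len g)%:R)); apply: cvgMr; exact: cvg_harmonic.
Unshelve. all: by end_near.
Qed.

Lemma span_commutator_cvg S : group_span S ->
  (opnorm (op k * S - S * op k) @[k --> \oo] --> (0 : R))%classic.
Proof.
move=> [s ->]; elim: s => [|p s IHs].
  under eq_fun do rewrite big_nil mulr0 mul0r subrr opnorm0.
  exact: cvg_cst.
rewrite big_cons; set S1 := \sum_(_ <- _) _ in IHs *.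
apply: (@squeeze_cvgr _ _ _ _ (fun=> 0) (fun k =>
    normc p.1 * opnorm (op k * lreg R p.2 - lreg R p.2 * op k) +
    opnorm (op k * S1 - S1 * op k))).
- apply: nearW => k; rewrite opnorm_ge0/=.
  have -> : op k * (p.1 *: lreg R p.2 + S1) - (p.1 *: lreg R p.2 + S1) * op k =
      p.1 *: (op k * lreg R p.2 - lreg R p.2 * op k) + (op k * S1 - S1 * op k).
    rewrite mulrDr mulrDl -bop_scalerAl -bop_scalerAr scalerBr.
    by rewrite opprD addrACA.
  by apply: le_trans (opnormD _ _) _; rewrite lerD2r opnormZ_le.
- exact: cvg_cst.
- rewrite -[X in (_ --> X)%classic]addr0; apply: cvgD => //.
  rewrite -[X in (_ --> X)%classic](mulr0 (normc p.1)); apply: cvgMr.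
  exact: lreg_commutator_cvg.
Qed.

Lemma cred_commutator_cvg T : T \in @cred_pred R F ->
  (opnorm (op k * T - T * op k) @[k --> \oo] --> (0 : R))%classic.
Proof.
move=> /cred_predP clT; apply/cvgr0Pnorm_lt => e e0.
have [|S spS TS] := clT (e / 8); first by rewrite divr_gt0.
have /cvgr0Pnorm_lt/(_ (e / 2)) := span_commutator_cvg spS.
rewrite divr_gt0// => /(_ isT); apply: filterS => k.
rewrite !ger0_norm ?opnorm_ge0// => kS.
have -> : op k * T - T * op k =
    (op k * S - S * op k) + (op k * (T - S) - (T - S) * op k).
  rewrite mulrBr mulrBl opprB addrACA addKr.
  by rewrite [X in _ = X - _]addrC subrK.
have op2 : opnorm (op k) <= 2 := opnorm_central_op_le R ab (tE k).
have d0 := opnorm_ge0 (T - S); have o0 := opnorm_ge0 (op k).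
have h1 : opnorm (op k * (T - S)) <= 2 * opnorm (T - S).
  by apply: le_trans (opnormM _ _) _; apply: ler_wpM2r.
have h2 : opnorm (- ((T - S) * op k)) <= 2 * opnorm (T - S).
  rewrite opnormN mulrC; apply: le_trans (opnormM _ _) _; exact: ler_wpM2l.
apply: le_lt_trans (opnormD _ _) _.
have := opnormD (op k * (T - S)) (- ((T - S) * op k)); lra.
Qed.

Definition central_seq : ellinf N := Ellinf central_term_bounded.

Lemma central_seqP (w : freeUltrafilter nat) :
  central_sequence_algebra N w (\pi_(ultrapower N w) central_seq)%qT.
Proof.
move=> x; rewrite /diag -!pi_ultrapowerM; apply/pi_ultrapowerP/asboolP.
apply: cvg_trans (cred_commutator_cvg (valP x)).
exact: cvg_app (@freeUltrafilter_tail w).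
Qed.

End Sequence.

End CentralSequence.

Theorem mainTheorem4 (R : realType) (w : freeUltrafilter nat)
    (n : nat) (hn : (2 <= n)%N) :
  let N := cred_norm R (freeGroup n) in
  ~ (forall x y : ultrapower N w,
       central_sequence_algebra N w x -> central_sequence_algebra N w y ->
       x * y = y * x).
Proof.
move=> N comm.
pose a : 'I_n * bool := (Ordinal (ltnW hn), true).
pose b : 'I_n * bool := (Ordinal hn, true).
have ab : b != a by [].
have ab' : b != invl a by [].
have h1 k : 1%g = 1%g :> freeGroup n \/ 1%g = ((shifter (4 * k).+1 ab')^-1)%g by left.
have h2 k : ((shifter (4 * k).+1 ab')^-1)%g = 1%g :> freeGroup n \/
    ((shifter (4 * k).+1 ab')^-1)%g = ((shifter (4 * k).+1 ab')^-1)%g :> freeGroup n by right.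
have := comm _ _ (central_seqP ab h1 w) (central_seqP ab h2 w).
rewrite -!pi_ultrapowerM => /pi_ultrapowerP/asboolP xy.
have wP := @ultra_proper _ _ (ultrasetP w).
have /cvgr_lt/(_ 2^-1) := xy; rewrite invr_gt0 ltr0n => /(_ isT) lt_w.
have [k] := filter_ex lt_w; apply/negP; rewrite -leNgt.
exact: central_op_noncommuting.
Qed.
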